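(* Let $d\ge 1$ be an integer, let $1<\beta<\infty$, suppose that $w$ is an $A_\beta$ weight on $\mathbb{R}^d$, and put $$r=\frac{\beta\left(1+2^{\beta d/(\beta-1)}\beta^{\beta/(\beta-1)}[w]_{A_\beta}^{1/(\beta-1)}\right)}{\beta+2^{\beta d/(\beta-1)}\beta^{\beta/(\beta-1)}[w]_{A_\beta}^{1/(\beta-1)}}\in(1,\beta).$$ Then $w$ is an $A_r$ weight and $$[w]_{A_r}\leq 2^{rd+r}[w]_{A_\beta}^{(r-1)/(\beta-1)}.$$
   Context: A weight is a locally integrable, positive function $w$ on $\mathbb{R}^d$. For $1<p<\infty$, the $A_p$ characteristic of $w$ is $$[w]_{A_p}=\sup_Q\left(\frac1{|Q|}\int_Q w\right)\left(\frac1{|Q|}\int_Q w^{-1/(p-1)}\right)^{p-1},$$ the supremum being over all cubes $Q\subset\mathbb{R}^d$ with sides parallel to the coordinate axes, where $|Q|$ denotes the Lebesgue measure of $Q$; $w$ is an $A_p$ weight if $[w]_{A_p}<\infty$. These definitions are used with $p=\beta$ and $p=r$. *)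

(* Defs.v *)
From HB Require Import structures.
From mathcomp Require Import all_boot all_order all_algebra.
From mathcomp Require Import all_classical all_reals all_analysis.
Set Implicit Arguments.
Unset Strict Implicit.
Unset Printing Implicit Defensive.
Import Order.TTheory GRing.Theory Num.Theory.
Import numFieldNormedType.Exports.
Local Open Scope classical_set_scope.
Local Open Scope ring_scope.

Section lebesgue_outer.
Context {R : realType} {d : nat}.
Local Open Scope ereal_scope.

Definition box (a b : 'rV[R]_d) : set 'rV[R]_d :=
  [set x | forall i, (a ord0 i <= x ord0 i <= b ord0 i)%R].

(* box a b is empty when b ord0 i < a ord0 i for some i, whence the Num.max *)
Definition box_volume (a b : 'rV[R]_d) : R :=
  (\prod_(i < d) Num.max 0 (b ord0 i - a ord0 i))%R.

(* countable covers include finite ones, so that set0 has the empty cover *)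
Definition box_cover (X : set 'rV[R]_d) (S : set ('rV[R]_d * 'rV[R]_d)) :=
  countable S /\ X `<=` \bigcup_(ab in S) box ab.1 ab.2.

Definition lebesgue_outer (X : set 'rV[R]_d) : \bar R :=
  ereal_inf [set \esum_(ab in S) (box_volume ab.1 ab.2)%:E | S in box_cover X].

Lemma box_volume_ge0 a b : (0 <= box_volume a b)%R.
Proof. by apply: prodr_ge0 => i _; rewrite le_max lexx. Qed.

Lemma lebesgue_outer_ge0 X : 0 <= lebesgue_outer X.
Proof.
apply: le_ereal_inf_tmp => _ [S _ <-].
by apply: esum_ge0 => ab _; rewrite lee_fin box_volume_ge0.
Qed.

Lemma lebesgue_outer0 : lebesgue_outer set0 = 0.
Proof.
apply/eqP; rewrite eq_le lebesgue_outer_ge0 andbT.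
apply: ereal_inf_lbound; exists set0; last by rewrite esum_set0.
by split; [exact: countable0|exact: sub0set].
Qed.

Lemma le_lebesgue_outer : {homo lebesgue_outer : A B / A `<=` B >-> A <= B}.
Proof.
move=> A B AB; apply: ereal_inf_le_tmp => _ [S [cS BS] <-].
by exists S => //; split => //; exact: subset_trans BS.
Qed.

Lemma lebesgue_outer_sigma_subadditive : sigma_subadditive lebesgue_outer.
Proof.
move=> A; have [[i ioo]|] := pselect (exists i, lebesgue_outer (A i) = +oo).
  rewrite (eseries_pinfty _ _ ioo) ?leey// => n _.
  by rewrite -ltNye (lt_le_trans _ (lebesgue_outer_ge0 _)).
rewrite -forallNE => Aoo.
apply/lee_addgt0Pr => e e0.
rewrite (le_trans _ (epsilon_trick _ _ (ltW e0)))//; last first.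
  by move=> n; exact: lebesgue_outer_ge0.
pose v (ab : 'rV[R]_d * 'rV[R]_d) := (box_volume ab.1 ab.2)%:E.
have v0 ab : 0 <= v ab by rewrite lee_fin box_volume_ge0.
pose P n S := box_cover (A n) S /\
  \esum_(ab in S) v ab <= lebesgue_outer (A n) + (e / (2 ^ n.+1)%:R)%:E.
have [G PG] : {G & forall n, P n (G n)}.
  apply: (@choice _ _ P) => n.
  have fA : lebesgue_outer (A n) \is a fin_num.
    by rewrite ge0_fin_numE ?lebesgue_outer_ge0// ltey; exact/eqP/Aoo.
  have en : (0 < e / (2 ^ n.+1)%:R)%R by rewrite divr_gt0// ltr0n expn_gt0.
  have [_ [S cS <-] xS] := lb_ereal_inf_adherent en fA.
  by exists S; split => //; exact: ltW.
apply: (@le_trans _ _ (\esum_(ab in \bigcup_n G n) v ab)).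
  apply: ereal_inf_lbound; exists (\bigcup_n G n) => //; split.
    by apply: bigcup_countable => // n _; exact: (PG n).1.1.
  move=> x [n _ /(PG n).1.2 [ab Gab xab]].
  by exists ab => //; exists n.
rewrite seqDU_bigcup_eq (@esum_bigcupT _ _ _ _ _ (@trivIset_seqDU _ _))//.
rewrite -nneseries_esumT; last by move=> n; exact: esum_ge0.
apply: lee_nneseries => [n _ _|n _ /=]; first by apply: esum_ge0 => ab _.
apply: le_trans (PG n).2.
rewrite (esum_mkcond (seqDU G n)) (esum_mkcond (G n)); apply: le_esum => ab _.
case: ifPn => [/set_mem Gab|_]; last by case: ifPn.
by rewrite mem_set//; exact: subset_seqDU Gab.
Qed.

HB.instance Definition _ := isOuterMeasure.Build R 'rV[R]_d lebesgue_outer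
  lebesgue_outer0 lebesgue_outer_ge0 le_lebesgue_outer
  lebesgue_outer_sigma_subadditive.

End lebesgue_outer.

(* the Caratheodory sigma-algebra of lebesgue_outer consists of all Lebesgue
   measurable sets, not only of the Borel sets *)
Definition euclid (R : realType) (d : nat) :=
  caratheodory_type (@lebesgue_outer R d).
HB.instance Definition _ (R : realType) (d : nat) :=
  Measurable.on (euclid R d).

Definition lebesgue_rV {R : realType} {d : nat} : set (euclid R d) -> \bar R :=
  @lebesgue_outer R d.
HB.instance Definition _ (R : realType) (d : nat) :=
  isMeasure.Build _ _ _ (@lebesgue_rV R d)
    (@caratheodory_measure0 _ _ (@lebesgue_outer R d))
    (@caratheodory_measure_ge0 _ _ (@lebesgue_outer R d))
    (@caratheodory_measure_sigma_additive _ _ (@lebesgue_outer R d)).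

Section weights.
Context {R : realType} {d : nat}.
Implicit Types (w : 'rV[R]_d -> R) (Q : set 'rV[R]_d) (p : R).
Local Open Scope ereal_scope.

Definition locally_integrable_rV w :=
  measurable_fun setT (w : euclid R d -> R) /\
  forall K : set 'rV[R]_d, compact K ->
    \int[lebesgue_rV]_(x in (K : set (euclid R d))) `|w x|%:E < +oo.

Definition weight w := locally_integrable_rV w /\ forall x, (0 < w x)%R.

Definition cube Q :=
  exists (a : 'rV[R]_d) (l : R), (0 < l)%R /\ Q = box a (a + const_mx l)%R.

Definition average Q w : \bar R :=
  (lebesgue_rV Q)^-1 *
  \int[lebesgue_rV]_(x in (Q : set (euclid R d))) (w x)%:E.

Definition Ap_char p w : \bar R :=
  ereal_sup [set average Q w *
                 average Q (fun x => w x `^ (- (1 / (p - 1))))%R `^ (p - 1)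
            | Q in cube].

Definition Ap_weight p w := weight w /\ Ap_char p w < +oo.

End weights.

(* Main.v *)
Require Import Defs.
From mathcomp Require Import all_boot all_order all_algebra.
From mathcomp Require Import all_classical all_reals all_analysis.
From mathcomp Require Import measurable_realfun ring lra.
Import Order.TTheory GRing.Theory Num.Theory.
Import numFieldNormedType.Exports.
Set Implicit Arguments.
Unset Strict Implicit.
Unset Printing Implicit Defensive.
Local Open Scope classical_set_scope.
Local Open Scope ring_scope.

(* The dual weight s = w^(-1/(beta-1)) satisfies a reverse Hoelder inequality
   with exponent 1 + e = (beta-1)/(r-1), which turns the A_beta bound into an A_r
   bound.  On the dyadic subcubes of a cube Q, Doob's inequality for the averages
   of 1/w with respect to w gives int_P M s <= a s(P) for every P, where M is the
   local dyadic maximal operator and a = beta^(1/(beta-1)) [w]^(1/(beta-1)).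
   Summing over the jumps of the running maximum of the averages of s, each of
   which is by a factor at most 2^d, one absorbs a multiple at most ln 2 of the
   left-hand side and obtains int_Q s (M s)^e <= (1 - ln 2)^-1 |Q| (s(Q)/|Q|)^(1+e).
   All this is done on trees of finite depth; the limit needs only that s <= M s
   almost everywhere.  The remaining factor [w]^(e(r-1)/(beta-1)) is absolute,
   because e is of the order of [w]^(-1/(beta-1)). *)

(** * Lebesgue measure of boxes *)

(** An injection of [S] into the naturals splits [S] into fibres [J n], each empty or a singleton,
    so ordinary countable subadditivity applies. *)
Lemma outer_measure_bigcup_esum (R : realType) (T : Type) (I : choiceType)
    (mu : {outer_measure set T -> \bar R}) (S : set I) (F : I -> set T) :
  countable S -> (mu (\bigcup_(i in S) F i) <= \esum_(i in S) mu (F i))%E.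
Proof.
move=> /countable_injP[f finj].
pose J n := [set i | S i /\ f i = n].
have SJ : S = \bigcup_(n in setT) J n.
  by apply/seteqP; split=> [i Si|i [n _ []//]]; exists (f i).
have tJ : trivIset setT J by move=> m n _ _ [i [[_ <-] [_ <-]]].
rewrite {2}SJ esum_bigcupT//; last by move=> i; exact: outer_measure_ge0.
rewrite -nneseries_esumT; last first.
  by move=> n; apply: esum_ge0 => i _; exact: outer_measure_ge0.
rewrite {1}SJ bigcup_bigcup.
apply: (le_trans (outer_measure_sigma_subadditive _ _)).
apply: lee_nneseries => [n _ _|n _]; first exact: outer_measure_ge0.
have [->|/set0P[i [Si fi]]] := eqVneq (J n) set0.
  by rewrite bigcup_set0 outer_measure0 esum_set0.
have -> : J n = [set i].
  apply/seteqP; split=> [j [Sj fj]|_ -> //]; apply: finj; rewrite ?inE//.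
  by rewrite fj fi.
by rewrite bigcup_set1 esum_set1//; exact: outer_measure_ge0.
Qed.

Section lebesgue_box.
Context {R : realType}.

Lemma lebesgue_outer_box_le d (a b : 'rV[R]_d) :
  (lebesgue_outer (box a b) <= (box_volume a b)%:E)%E.
Proof.
apply: ereal_inf_lbound; exists [set (a, b)].
  split; first by apply/finite_set_countable; exact: finite_set1.
  by move=> x xab; exists (a, b).
by rewrite esum_set1//= lee_fin box_volume_ge0.
Qed.

Definition row_set d (x : 'rV[R]_d) (i : 'I_d) (c : R) : 'rV[R]_d :=
  \row_j (if j == i then c else x ord0 j).

(* Hyperplanes split a box into two boxes whose volumes add up, whatever the
   side to which the points of the hyperplane itself are assigned. *)
Lemma caratheodory_halfspace d (i : 'I_d) (c : R) (H : set 'rV[R]_d) :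
  [set x : 'rV[R]_d | x ord0 i < c] `<=` H ->
  H `<=` [set x : 'rV[R]_d | x ord0 i <= c] ->
  measurable (H : set (euclid R d)).
Proof.
move=> cH Hc; apply: le_caratheodory_measurable => X /=.
apply: le_ereal_inf_tmp => _ [S [cS XS] <-].
have XI Y : X `&` Y `<=` \bigcup_(ab in S) (box ab.1 ab.2 `&` Y).
  by move=> x [/XS[ab Sab xab] Yx]; exists ab.
apply: (@le_trans _ _ (\esum_(ab in S) lebesgue_outer (box ab.1 ab.2 `&` H) +
    \esum_(ab in S) lebesgue_outer (box ab.1 ab.2 `&` ~` H))%E).
  by apply: leeD; (apply: le_trans; first exact/le_lebesgue_outer/XI);
    exact: outer_measure_bigcup_esum.
rewrite -esumD; try by move=> *; exact: lebesgue_outer_ge0.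
apply: le_esum => -[a b] _ /=.
pose b' := row_set b i (Num.min (b ord0 i) c).
pose a' := row_set a i (Num.max (a ord0 i) c).
apply: (@le_trans _ _ ((box_volume a b')%:E + (box_volume a' b)%:E)%E).
  apply: leeD; (apply: le_trans; last exact: lebesgue_outer_box_le).
    apply: le_lebesgue_outer => x [xab /Hc/= xc] j; rewrite mxE.
    case: eqVneq => [->|_]; last exact: xab.
    by rewrite le_min xc andbT; exact: xab.
  apply: le_lebesgue_outer => x [xab Hx] j; rewrite mxE.
  case: eqVneq => [->|_]; last exact: xab.
  have cx : c <= x ord0 i.
    by rewrite leNgt; apply/negP => xc; apply/Hx/cH.
  by rewrite ge_max cx andbT; exact: xab.
rewrite -EFinD lee_fin /box_volume.
rewrite [X in X + _ <= _](bigD1 i)//= [X in _ + X <= _](bigD1 i)//=.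
rewrite [leRHS](bigD1 i)//=.
rewrite [X in _ * X + _](eq_bigr (fun j => Num.max 0 (b ord0 j - a ord0 j))).
  rewrite [X in _ + _ * X](eq_bigr (fun j => Num.max 0 (b ord0 j - a ord0 j))).
    rewrite -mulrDl ler_wpM2r//; first by apply: prodr_ge0 => *; rewrite le_max lexx.
    rewrite !mxE eqxx.
    rewrite /Num.max /Num.min; do !case: ifPn => //; lra.
  by move=> j /negbTE ji; rewrite mxE ji.
by move=> j /negbTE ji; rewrite mxE ji.
Qed.

Lemma measurable_halfspace_le d (i : 'I_d) (c : R) :
  measurable ([set x : 'rV[R]_d | x ord0 i <= c] : set (euclid R d)).
Proof. by apply: (@caratheodory_halfspace d i c) => // x /= /ltW. Qed.

Lemma measurable_halfspace_lt d (i : 'I_d) (c : R) :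
  measurable ([set x : 'rV[R]_d | x ord0 i < c] : set (euclid R d)).
Proof. by apply: (@caratheodory_halfspace d i c) => // x /= /ltW. Qed.

Lemma measurable_box d (a b : 'rV[R]_d) :
  measurable (box a b : set (euclid R d)).
Proof.
rewrite (_ : box a b = \bigcap_(i in [set: 'I_d])
    ((~` [set x : 'rV[R]_d | x ord0 i < a ord0 i]) `&`
     [set x : 'rV[R]_d | x ord0 i <= b ord0 i])).
  apply: fin_bigcap_measurable; first exact: finite_finset.
  move=> i _; apply: measurableI; last exact: measurable_halfspace_le.
  by apply: measurableC; exact: measurable_halfspace_lt.
apply/seteqP; split=> x xab i => [_|]/=.
  by have /andP[? ?] := xab i; split=> //; apply/negP; rewrite -leNgt.
by have [/negP] := xab i I; rewrite -leNgt /= => -> ->.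
Qed.

(* Induction on the dimension, integrating the slices of the covering over the
   first coordinate. *)
Lemma box_volume_le_cover d (a b : 'rV[R]_d) (A B : nat -> 'rV[R]_d)
    (c : nat -> R) :
  (forall k, 0 <= c k) ->
  (forall x, box a b x ->
     (1 <= \sum_(k <oo) (c k * \1_(box (A k) (B k)) x)%:E)%E) ->
  ((box_volume a b)%:E <= \sum_(k <oo) (c k * box_volume (A k) (B k))%:E)%E.
Proof.
elim: d => [|d IH] in a b A B c * => c0 cov.
  rewrite /box_volume big_ord0.
  have -> : (fun n => \sum_(0 <= k < n)
      (c k * \prod_(i < 0) Num.max 0 (B k ord0 i - A k ord0 i))%:E)%E =
      (fun n => \sum_(0 <= k < n) (c k * \1_(box (A k) (B k)) a)%:E)%E.
    apply/funext => n; apply: eq_bigr => k _.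
    by rewrite big_ord0 indicE mem_set//; case.
  by apply: cov; case.
pose tl (x : 'rV[R]_d.+1) : 'rV[R]_d := \row_j x ord0 (lift ord0 j).
have volS (u v : 'rV[R]_d.+1) : box_volume u v =
    Num.max 0 (v ord0 ord0 - u ord0 ord0) * box_volume (tl u) (tl v).
  rewrite /box_volume big_ord_recl; congr (_ * _).
  by apply: eq_bigr => i _; rewrite !mxE.
pose cons (s : R) (y : 'rV[R]_d) : 'rV[R]_d.+1 :=
  \row_j (if unlift ord0 j is Some k then y ord0 k else s).
have boxS (u v : 'rV[R]_d.+1) s y : box u v (cons s y) <->
    (u ord0 ord0 <= s <= v ord0 ord0) /\ box (tl u) (tl v) y.
  split=> [uv|[usv uvy] i].
    split; first by have := uv ord0; rewrite mxE unlift_none.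
    by move=> i; have := uv (lift ord0 i); rewrite !mxE liftK.
  rewrite mxE; case: unliftP => [j ->|-> //].
  by have := uvy j; rewrite !mxE.
have volint (u v : 'rV[R]_d.+1) : ((box_volume u v)%:E =
    \int[lebesgue_measure]_s ((box_volume (tl u) (tl v))%:E *
      (\1_`[u ord0 ord0, v ord0 ord0] s)%:E))%E.
  rewrite ge0_integralZl//; last 2 first.
  - by apply/measurable_EFinP; exact: measurable_indic.
  - by rewrite lee_fin box_volume_ge0.
  rewrite integral_indic// setIT volS mulrC EFinM/= lebesgue_measure_itv/=.
  congr (_ * _)%E; rewrite lte_fin; case: ifPn => uv.
    by rewrite -EFinB max_r// subr_ge0 ltW.
  by rewrite max_l// subr_le0 leNgt.
rewrite volint.
under eq_eseriesr do rewrite EFinM volint.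
have mi (u v : R) : measurable_fun setT (fun s => (\1_`[u, v] s)%:E : \bar R).
  by apply/measurable_EFinP; exact: measurable_indic.
have mT (u v : 'rV[R]_d.+1) : measurable_fun setT (fun s =>
   ((box_volume (tl u) (tl v))%:E *
      (\1_`[u ord0 ord0, v ord0 ord0] s)%:E)%E).
  by apply: measurable_funeM; exact: mi.
have pT (u v : 'rV[R]_d.+1) s : (0 <= (box_volume (tl u) (tl v))%:E *
      (\1_`[u ord0 ord0, v ord0 ord0] s)%:E)%E.
  by rewrite -EFinM lee_fin mulr_ge0// box_volume_ge0.
rewrite (eq_eseriesr (g := fun k => (\int[lebesgue_measure]_s ((c k)%:E *
   ((box_volume (tl (A k)) (tl (B k)))%:E *
      (\1_`[A k ord0 ord0, B k ord0 ord0] s)%:E)))%E)); last first.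
  by move=> k _; rewrite [RHS]ge0_integralZl//; [exact: mT|rewrite lee_fin].
(* Tonelli: once series and integral are exchanged, it suffices to compare the integrands slice by
   slice. *)
rewrite -integral_nneseries//; last 2 first.
- by move=> k; apply: measurable_funeM; exact: mT.
- by move=> k s _; rewrite mule_ge0// lee_fin.
apply: ge0_le_integral => //.
- exact: mT.
- apply: ge0_emeasurable_sum => [k s _ _|k _]; first by rewrite mule_ge0// lee_fin.
  by apply: measurable_funeM; exact: mT.
move=> s _.
rewrite indicE; case: (boolP (s \in _)) => [/set_mem|_]; last first.
  by rewrite mule0; apply: nneseries_ge0 => k _ _; rewrite mule_ge0// lee_fin.
rewrite /= in_itv/= mule1 => sab.
under eq_eseriesr do rewrite muleC -muleA -!EFinM mulrC [X in X * _]mulrC.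
(* The coefficients absorb the indicator of the first-coordinate interval at [s]; this is why the
   statement carries arbitrary weights [c]. *)
apply: (IH (tl a) (tl b) (fun k => tl (A k)) (fun k => tl (B k))
  (fun k => c k * \1_`[A k ord0 ord0, B k ord0 ord0] s)).
  by move=> k; rewrite mulr_ge0.
move=> y aby; have /cov : box a b (cons s y) by apply/boxS.
rewrite (eq_eseriesr (g := fun k => (c k * \1_`[A k ord0 ord0, B k ord0 ord0] s
  * \1_(box (tl (A k)) (tl (B k))) y)%:E))// => k _.
rewrite -mulrA; congr (_ * _)%:E.
rewrite !indicE -natrM mulnb; congr (_ %:R); congr nat_of_bool.
apply/idP/andP => [/set_mem/boxS[]|[]].
  by move=> ? ?; split; apply/mem_set => //=; rewrite in_itv.
by move=> /set_mem/=; rewrite in_itv/= => ? /set_mem ?; apply/mem_set/boxS.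
Qed.

(** Turns a sum over a cover into a series indexed by naturals. The indicator of [K] silences the
    indices outside the range of the injection, where [e] takes the default value [i0]. *)
Lemma countable_esum_seq (I : choiceType) (i0 : I) (S : set I) : countable S ->
  exists (K : set nat) (e : nat -> I),
    (forall i, S i -> exists2 k, K k & e k = i) /\
    forall f : I -> R, (forall i, 0 <= f i) ->
      (\esum_(i in S) (f i)%:E = \sum_(k <oo) (\1_K k * f (e k))%:E)%E.
Proof.
move=> /countable_injP[g ginj].
pose e n := xget i0 [set i | S i /\ g i = n].
have eg i : S i -> e (g i) = i.
  move=> Si; have [Se ge] : [set j | S j /\ g j = g i] (e (g i)).
    by apply: (@xgetI _ _ _ i).
  by apply: ginj; rewrite ?inE.
exists (g @` S), e; split=> [i Si|f f0].
  by exists (g i); [exists i|exact: eg].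
rewrite nneseries_esumT => [|k]; last by rewrite lee_fin mulr_ge0.
transitivity (\esum_(k in g @` S) (f (e k))%:E)%E.
  rewrite (reindex_esum S (g @` S) g); last exact: inj_bij.
  by apply: eq_esum => i Si; rewrite eg.
rewrite esum_mkcond; apply: eq_esum => k _; rewrite indicE.
by case: ifPn => _; rewrite ?mul1r ?mul0r.
Qed.

Lemma lebesgue_box d (a b : 'rV[R]_d) :
  lebesgue_rV (box a b : set (euclid R d)) = (box_volume a b)%:E.
Proof.
apply/eqP; rewrite eq_le lebesgue_outer_box_le/=.
apply: le_ereal_inf_tmp => _ [S [cS abS] <-].
have [K [e [Ke ->]]] := countable_esum_seq (a, b) cS; last first.
  by move=> *; exact: box_volume_ge0.
apply: box_volume_le_cover => // x /abS[ab /Ke[k Kk eab] xab].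
apply: (@le_trans _ _ (\sum_(0 <= j < k.+1)
  (\1_K j * \1_(box (e j).1 (e j).2) x)%:E)%E); last first.
  by apply: nneseries_lim_ge => j _ _; rewrite lee_fin mulr_ge0.
rewrite big_nat_recr//= !indicE eab !mem_set//=.
by rewrite (mul1r (1 : R)) leeDr// sume_ge0.
Qed.

(* half-open, so that the 2^d dyadic children of a cube partition it *)
Definition hcube d (a : 'rV[R]_d) (l : R) : set (euclid R d) :=
  [set x : 'rV[R]_d | forall i, a ord0 i <= x ord0 i < a ord0 i + l].

Lemma measurable_hcube d (a : 'rV[R]_d) (l : R) : measurable (hcube a l).
Proof.
rewrite (_ : hcube a l = \bigcap_(i in [set: 'I_d])
    ((~` [set x : 'rV[R]_d | x ord0 i < a ord0 i]) `&`
     [set x : 'rV[R]_d | x ord0 i < a ord0 i + l])).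
  apply: fin_bigcap_measurable; first exact: finite_finset.
  move=> i _; apply: measurableI; last exact: measurable_halfspace_lt.
  by apply: measurableC; exact: measurable_halfspace_lt.
apply/seteqP; split=> x xab i => [_|]/=.
  by have /andP[? ?] := xab i; split=> //; apply/negP; rewrite -leNgt.
by have [/negP] := xab i I; rewrite -leNgt /= => -> ->.
Qed.

Definition cbox d (a : 'rV[R]_d) (l : R) : set (euclid R d) :=
  box a (a + const_mx l).

Lemma hcube_cbox d (a : 'rV[R]_d) l : hcube a l `<=` cbox a l.
Proof. by move=> x xa i; rewrite !mxE; have /andP[-> /ltW] := xa i. Qed.

Lemma lebesgue_cbox d (a : 'rV[R]_d) l : 0 < l ->
  lebesgue_rV (cbox a l) = (l ^+ d)%:E.
Proof.
move=> l0; rewrite lebesgue_box /box_volume; congr EFin.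
rewrite (eq_bigr (fun=> l)); first by rewrite prodr_const card_ord.
by move=> i _; rewrite !mxE addrAC subrr add0r max_r// ltW.
Qed.

(** The difference lies in the union of the upper faces, which are boxes with one side of length
    zero. *)
Lemma lebesgue_cboxD_hcube d (a : 'rV[R]_d) l :
  lebesgue_rV (cbox a l `\` hcube a l) = 0%E.
Proof.
apply/eqP; rewrite eq_le measure_ge0 andbT.
pose F (i : 'I_d) : set (euclid R d) :=
  box (row_set a i (a ord0 i + l)) (a + const_mx l).
apply: (@le_trans _ _ (lebesgue_rV (\bigcup_(i in [set: 'I_d]) F i))).
  apply: le_lebesgue_outer => x [xa /existsNP[i /negP xi]].
  exists i => // j; have := xa j; rewrite !mxE; case: eqVneq => [->|//].
  by move=> /andP[ax ->]; rewrite ax/= -leNgt in xi; rewrite xi.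
apply: (le_trans (@outer_measure_bigcup_esum _ _ _ _ _ _ _)).
  by apply: finite_set_countable; exact: finite_finset.
rewrite esum1// => i _; apply/eqP; rewrite eq_le lebesgue_outer_ge0 andbT.
apply: (le_trans (lebesgue_outer_box_le _ _)).
by rewrite lee_fin /box_volume (bigD1 i)//= !mxE eqxx subrr max_l// mul0r.
Qed.

Lemma lebesgue_hcube d (a : 'rV[R]_d) l : 0 < l ->
  lebesgue_rV (hcube a l) = (l ^+ d)%:E.
Proof.
move=> l0; rewrite -(lebesgue_cbox a l0).
have mC : measurable (cbox a l) by exact: measurable_box.
have := measureDI (@lebesgue_rV R d) mC (measurable_hcube a l).
by rewrite setIidr//; [rewrite [X in (X + _)%E]lebesgue_cboxD_hcube add0e|exact: hcube_cbox].
Qed.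

Lemma ge0_integral_cbox_hcube d (a : 'rV[R]_d) l (f : euclid R d -> \bar R) :
  measurable_fun setT f -> (forall x, (0 <= f x)%E) ->
  (\int[lebesgue_rV]_(x in cbox a l) f x =
   \int[lebesgue_rV]_(x in hcube a l) f x)%E.
Proof.
move=> mf f0.
rewrite (@ge0_negligible_integral _ _ _ _ _ (cbox a l `\` hcube a l))//.
- by rewrite setDD setIidr//; exact: hcube_cbox.
- by apply: measurableD; [exact: measurable_box|exact: measurable_hcube].
- exact: measurable_box.
- exact: measurable_funS mf.
- exact: lebesgue_cboxD_hcube.
Qed.

End lebesgue_box.

(** * A reverse Hoelder inequality on finite trees *)

Section scalar.
Context {R : realType}.
Implicit Types m y e : R.

(** Here [b] stands for beta and [q1] for 1/(beta-1); the relation [b * q1 = q1 + 1] makes [q1 + 1]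
    the conjugate exponent of [b]. *)
Lemma conjugate_gt0 (b q1 : R) : 1 < b -> b * q1 = q1 + 1 -> 0 < q1.
Proof. by move=> b1 bq; rewrite -(@pmulr_rgt0 _ (b - 1)) ?subr_gt0//; lra. Qed.

Lemma conjugate_inv (b q1 : R) : 1 < b -> b * q1 = q1 + 1 -> q1^-1 = b - 1.
Proof.
move=> b1 bq; have q10 := conjugate_gt0 b1 bq.
apply: (mulIf (lt0r_neq0 q10)); rewrite mulVf ?gt_eqF// mulrBl bq; ring.
Qed.

Lemma powR_young (b q1 m f : R) : 1 < b -> b * q1 = q1 + 1 -> 0 <= m -> 0 <= f ->
  m `^ q1 * f <= m * m `^ q1 / b + f * f `^ q1 / (q1 + 1).
Proof.
move=> b1 bq m0 f0.
have q10 := conjugate_gt0 b1 bq.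
have b0 : 0 < b by lra.
have pw x : 0 <= x -> x `^ (q1 + 1) = x * x `^ q1.
  move=> x0; have [->|x1] := eqVneq x 0.
    by rewrite powR0 ?mul0r//; lra.
  by rewrite powRD ?x1 ?implybT// powRr1// mulrC.
have := @conjugate_powR R (m `^ q1) f b (q1 + 1) (powR_ge0 _ _) f0 b0.
rewrite -powRrM mulrC [q1 * b]mulrC bq !pw//; apply; first by lra.
have bq0 : b * q1 != 0 by rewrite gt_eqF// mulr_gt0.
by rewrite -bq -[RHS](divff bq0) {2}bq; field; rewrite !gt_eqF.
Qed.

(** Young's inequality for [m / b] and [f], multiplied by [(q1 + 1) * b]^
    q1[. The scaling by]b[produces the constant]b [^ q1] of Doob's inequality. *)
Lemma powR_young_scaled (b q1 m f : R) : 1 < b -> b * q1 = q1 + 1 ->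
  0 <= m -> 0 <= f ->
  (q1 + 1) * (m `^ q1 * f) <= b `^ q1 * (f * f `^ q1) + q1 / b * (m * m `^ q1).
Proof.
move=> b1 bq m0 f0.
have b0 : 0 < b by lra.
have q10 := conjugate_gt0 b1 bq.
have mb : 0 <= m / b by rewrite divr_ge0// ltW.
have := powR_young b1 bq mb f0.
have := powR_gt0 q1 b0; set B := b `^ q1 => B0.
have -> : m `^ q1 = (m / b) `^ q1 * B by rewrite -powRM ?(ltW b0)// divfK ?gt_eqF.
set X := (m / b) `^ q1 => h.
have := ler_wpM2l (mulr_ge0 (addr_ge0 (ltW q10) ler01) (ltW B0)) h.
rewrite -subr_ge0 => h'; rewrite -subr_ge0; apply: (le_trans h').
rewrite le_eqVlt; apply/orP; left; apply/eqP.
have -> : q1 / b = (q1 + 1) / b / b by rewrite -bq; field; rewrite gt_eqF.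
by field; rewrite !gt_eqF//; lra.
Qed.

(** From exp(-x) >= 1 - x one gets y^e - m^e <= e y^e ln(y/m). The logarithmic hypothesis then
    trades the increment of the power e, times y, for the increment of the power 1 + e. *)
Lemma powR_jump (D L e m y : R) : 0 < m -> m <= y -> 0 <= e ->
  ln (y / m) <= D * L * (1 - m / y) -> 0 <= D * L ->
  (y `^ e - m `^ e) * y <= e * (D * L) * (y * y `^ e - m * m `^ e).
Proof.
move=> m0 my e0 hD DL.
have y0 : 0 < y by lra.
have h1 : y `^ e * (1 - e * ln (y / m)) <= m `^ e.
  have -> : m `^ e = y `^ e * expR (- (e * ln (y / m))).
    by rewrite /powR !gt_eqF// -expRD ln_div ?posrE//; congr expR; ring.
  rewrite ler_wpM2l ?powR_ge0//; exact: (le_trans _ (expR_ge1Dx _)).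
have h2 : y `^ e - m `^ e <= y `^ e * (e * (D * L * (1 - m / y))).
  apply: (@le_trans _ _ (y `^ e * (e * ln (y / m)))); first by lra.
  by rewrite ler_wpM2l ?powR_ge0// ler_wpM2l.
apply: (le_trans (ler_wpM2r (ltW y0) h2)).
have -> : y `^ e * (e * (D * L * (1 - m / y))) * y =
   e * (D * L) * (y * y `^ e - m * y `^ e) by field; rewrite gt_eqF.
apply: ler_wpM2l; first by rewrite mulr_ge0.
rewrite lerD2l lerN2; apply: ler_wpM2l; first exact: ltW.
by rewrite ge0_ler_powR// nnegrE ltW.
Qed.

(** Multiplying the bound on [Z] by [c] gives c Z (1 - L) <= L X when c Z >= 0. As the sign of [Z]
    is not known, the case c Z < 0 is treated apart, where the claim is immediate. *)
Lemma le_absorb (a c L X Z : R) : 0 <= X -> 0 <= c -> 0 <= L -> L < 1 ->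
  a * c <= L -> Z <= a * X + a * c * Z -> (X + c * Z) * (1 - L) <= X.
Proof.
move=> X0 c0 L0 L1 acL hZ.
have h1 := ler_wpM2l c0 hZ.
have h2 := ler_wpM2r X0 acL.
have h3 := mulr_ge0 L0 X0.
case: (leP 0 (c * Z)) => y0; first by have := ler_wpM2r y0 acL; lra.
have : c * Z * (1 - L) <= 0 by rewrite mulr_le0_ge0 ?subr_ge0// ltW.
lra.
Qed.

End scalar.

(** * Running maxima on a finite tree *)

Section tree.
Context {R : realType} {T : Type} {I : finType}.
Variables (ch : T -> I -> T).

(* m is the running maximum of u along the path from the root *)
Fixpoint pathsum (u : T -> R) (g : T -> R -> R) (N : nat) (P : T) (m : R) : R :=
  if N is N'.+1
  then \sum_i pathsum u g N' (ch P i) (Num.max m (u (ch P i))) else g P m.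

(** For a dyadic cube, [v], [s] and [w] are its volume and the masses of the dual weight and of the
    weight. The other parameters are D = 2^d, t = [w]^(1/(beta-1)) and an upper bound L of ln 2;
    [hold] is Hoelder's inequality and [hAp] the A_beta condition. *)
Variables (v s w : T -> R) (b q1 t D L e : R).
Hypotheses (v0 : forall P, 0 < v P) (s0 : forall P, 0 < s P)
  (w0 : forall P, 0 < w P).
Hypotheses (vch : forall P, v P = \sum_i v (ch P i))
  (sch : forall P, s P = \sum_i s (ch P i))
  (wch : forall P, w P = \sum_i w (ch P i)).
Hypothesis vD : forall P i, v P = D * v (ch P i).
Hypotheses (b1 : 1 < b) (bq : b * q1 = q1 + 1).
Hypothesis hold : forall P, (v P / w P) `^ q1 * v P <= s P.
Hypothesis hAp : forall P, s P / v P <= t * (v P / w P) `^ q1.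
Hypotheses (D0 : 0 < D) (L0 : 0 <= L) (L1 : L < 1) (e0 : 0 <= e) (t0 : 0 <= t).
(* holds for D = 2 ^ d and L >= ln 2 *)
Hypothesis hD : forall y, 1 <= y -> y <= D -> ln y <= D * L * (1 - y^-1).
Hypothesis he : e * D * (b `^ q1 * t) <= 1.

Let q10 : 0 < q1.
Proof. exact: conjugate_gt0 bq. Qed.

Let lam P := s P / v P.
Let f P := v P / w P.
Let lam_gt0 P : 0 < lam P. Proof. by rewrite divr_gt0. Qed.
Let f_gt0 P : 0 < f P. Proof. by rewrite divr_gt0. Qed.

(* Doob's L^q inequality for the martingale f under the measure w, with a
   supersolution that makes it provable by induction on the depth. *)
Lemma pathsum_doob N P m : 0 <= m ->
  pathsum f (fun P m => v P * m `^ q1) N P m <=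
  b `^ q1 * s P + q1 * (m * m `^ q1 * w P / b - m `^ q1 * v P).
Proof.
elim: N P m => [|N IH] P m m0 /=.
  have fw : f P * w P = v P by rewrite divfK// gt_eqF.
  have h1 : b `^ q1 * (f P `^ q1 * v P) <= b `^ q1 * s P.
    by rewrite ler_wpM2l ?powR_ge0//; exact: hold.
  have := ler_wpM2r (ltW (w0 P)) (powR_young_scaled b1 bq m0 (ltW (f_gt0 P))).
  rewrite -fw in h1 *; lra.
rewrite sch wch vch !(mulr_sumr, mulr_suml) -sumrB mulr_sumr -big_split/=.
apply: ler_sum => i _; set Pi := ch P i.
apply: (le_trans (IH _ _ _)); first by rewrite le_max m0.
rewrite lerD2l ler_wpM2l ?(ltW q10)//.
(* Without a jump both sides agree. At a jump from [m] to [f Pi] the supersolution must not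
   increase, which is exactly Young's inequality because [v Pi = f Pi * w Pi]. *)
rewrite /Num.max; case: ifPn => // mf.
have fw : f Pi * w Pi = v Pi by rewrite divfK// gt_eqF.
have := ler_wpM2r (ltW (w0 Pi)) (powR_young b1 bq m0 (ltW (f_gt0 Pi))).
rewrite -fw -bq.
have -> : f Pi * f Pi `^ q1 / (b * q1) = f Pi * f Pi `^ q1 - f Pi * f Pi `^ q1 / b.
  rewrite invfM (conjugate_inv b1 bq); field.
  by rewrite gt_eqF// (lt_trans ltr01).
lra.
Qed.

(** By [hAp] each [lam] is at most t f^q1. As x -> t x^q1 is nondecreasing, this relation passes to
    the running maxima and so to every leaf. *)
Lemma pathsum_le_doob N P m m' : m <= t * m' `^ q1 -> 0 <= m' ->
  pathsum lam (fun P m => v P * m) N P m <=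
  t * pathsum f (fun P m => v P * m `^ q1) N P m'.
Proof.
elim: N P m m' => [|N IH] P m m' mm m'0 /=.
  by rewrite mulrCA ler_wpM2l// ltW.
rewrite mulr_sumr; apply: ler_sum => i _; apply: IH; last by rewrite le_max m'0.
have mono x y : 0 <= x -> x <= y -> t * x `^ q1 <= t * y `^ q1.
  move=> x0 xy; rewrite ler_wpM2l//; apply: ge0_ler_powR => //.
  - exact: ltW.
  - by rewrite nnegrE (le_trans x0).
rewrite ge_max; apply/andP; split.
  by apply: (le_trans mm); apply: mono; rewrite // le_max lexx.
apply: (le_trans (hAp _)); apply: mono; first exact: ltW (f_gt0 _).
by rewrite le_max lexx orbT.
Qed.

Let a := b `^ q1 * t.

(* The A_infinity property of s, with the constant that the A_p bound gives. *)
Lemma pathsum_max_le N P : pathsum lam (fun P m => v P * m) N P (lam P) <= a * s P.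
Proof.
apply: (le_trans (@pathsum_le_doob N P (lam P) (f P) (hAp P) (ltW (f_gt0 P)))).
apply: (le_trans (ler_wpM2l t0 (pathsum_doob N P (ltW (f_gt0 P))))).
rewrite mulrDr mulrCA mulrA -/a gerDl mulr_ge0_le0// mulr_ge0_le0 ?(ltW q10)//.
have -> : f P * f P `^ q1 * w P = f P `^ q1 * v P.
  by rewrite mulrAC divfK ?gt_eqF// mulrC.
rewrite subr_le0 ler_pdivrMr ?(lt_trans ltr01)// ler_peMr// ?ltW//.
by rewrite mulr_gt0// powR_gt0.
Qed.

Lemma s_lam P : s P = lam P * v P. Proof. by rewrite divfK// gt_eqF. Qed.

(* Only the jumps of the running maximum contribute to the difference, and a
   jump is by a factor of at most D. *)
Lemma pathsum_record (k : T -> R -> R) (a' : R) : 0 <= a' ->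
  (forall N P, pathsum lam k N P (lam P) <= a' * s P) ->
  forall N P m, lam P <= m ->
  pathsum lam (fun P m => m `^ e * k P m) N P m <=
  m `^ e * pathsum lam k N P m + a' * (e * (D * L)) *
   (pathsum lam (fun P m => m * m `^ e * v P) N P m - m * m `^ e * v P).
Proof.
move=> a'0 hk; elim=> [|N IH] P m lm /=; first by rewrite subrr mulr0 addr0.
rewrite [in X in _ - X]vch !mulr_sumr -sumrB mulr_sumr -big_split/=.
apply: ler_sum => i _; set Pi := ch P i.
have lmi : lam Pi <= Num.max m (lam Pi) by rewrite le_max lexx orbT.
apply: (le_trans (IH _ _ lmi)).
rewrite /Num.max; case: ifPn => // ml.
set F := pathsum _ _ _ _ _; set K := pathsum _ _ _ _ _.
have m0 : 0 < m by exact: lt_le_trans lm.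
(* A child has at most the mass of its parent and 1/D of its volume, so the average grows by a
   factor at most [D]. *)
have jmp : lam Pi <= D * m.
  apply: (@le_trans _ _ (D * lam P)); last by rewrite ler_wpM2l// ltW.
  have -> : D * lam P = s P / v Pi by rewrite /lam (vD P i); field; rewrite !gt_eqF.
  rewrite ler_wpM2r ?invr_ge0 ?(ltW (v0 _))// (sch P) (bigD1 i)//= lerDl.
  by apply: sumr_ge0 => *; exact: ltW.
have DL : 0 <= D * L by rewrite mulr_ge0// ltW.
have hj : ln (lam Pi / m) <= D * L * (1 - m / lam Pi).
  rewrite -[m / lam Pi]invf_div; apply: hD.
    by rewrite ler_pdivlMr// mul1r ltW.
  by rewrite ler_pdivrMr.
have J := powR_jump m0 (ltW ml) e0 hj DL.
have le_pow : 0 <= lam Pi `^ e - m `^ e.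
  by rewrite subr_ge0 ge0_ler_powR// ?nnegrE ?ltW.
(* After a jump the running maximum restarts at [lam Pi], so [hk] applies to the subtree of [Pi].
   Its bound is [a' * lam Pi * v Pi], to which [J] applies. *)
have h1 := ler_wpM2l le_pow (hk N Pi).
have h2 := ler_wpM2l a'0 (ler_wpM2r (ltW (v0 Pi)) J).
rewrite s_lam -/F in h1; rewrite -/K in h1.
lra.
Qed.

(** [pathsum_record] is used twice: with leaf function [s] it bounds the left-hand side by X + c
    (Phi - X), and with [v P * m] it gives Phi <= a X + a c (Phi - X). Since a c <= L < 1, the last
    term is absorbed. *)
Lemma tree_reverse_hoelder N P :
  pathsum lam (fun P m => m `^ e * s P) N P (lam P) <=
  (1 - L)^-1 * (lam P `^ e * s P).
Proof.
have sconst M Q m : pathsum lam (fun P _ => s P) M Q m = s Q.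
  elim: M Q m => [//|M IH] Q m /=.
  by rewrite [RHS]sch; apply: eq_bigr => i _; rewrite IH.
pose Phi := pathsum lam (fun P m => m * m `^ e * v P) N P (lam P).
have a0 : 0 <= a by rewrite mulr_ge0// powR_ge0.
have ks M Q : pathsum lam (fun P _ => s P) M Q (lam Q) <= 1 * s Q.
  by rewrite sconst mul1r.
have hB := @pathsum_record (fun P _ => s P) 1 ler01 ks N P _ (lexx _).
have hA := @pathsum_record (fun P m => v P * m) a a0 pathsum_max_le N P _ (lexx _).
rewrite sconst mul1r -/Phi in hB.
rewrite -/Phi (_ : pathsum _ _ _ _ _ = Phi) in hA; last first.
  rewrite /Phi; elim: (N) (P) (lam P) => [Q m|M IH Q m] /=; first by ring.
  by apply: eq_bigr => i _; rewrite IH.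
have lX : lam P * lam P `^ e * v P = lam P `^ e * s P by rewrite s_lam; ring.
rewrite lX in hA hB.
have le0 := powR_ge0 (lam P) e.
have hG := ler_wpM2l le0 (pathsum_max_le N P).
have X0 : 0 <= lam P `^ e * s P by rewrite mulr_ge0// ltW.
have c0 : 0 <= e * (D * L) by rewrite !mulr_ge0// ltW.
have acL : a * (e * (D * L)) <= L.
  by rewrite (_ : _ * _ = e * D * a * L); [rewrite ler_piMl|ring].
rewrite mulrC ler_pdivlMr ?subr_gt0//.
set X := _ * s P in hA hB hG X0 *; set c := e * _ in hA hB c0 acL *.
set Psi := pathsum _ _ _ _ _ in hB *.
have hA' : Phi - X <= a * X + a * c * (Phi - X) 
  by rewrite /X in hA X0 *; lra.
have L10 : 0 <= 1 - L by rewrite subr_ge0 ltW.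
have hBL := ler_wpM2r L10 hB.
apply: (le_trans hBL).
exact: le_absorb acL hA'.
Qed.

End tree.

(** * Dyadic cubes *)

Lemma measurable_fun_bigsetU d1 d2 (T1 : measurableType d1)
    (T2 : measurableType d2) (I : Type) (s : seq I) (F : I -> set T1)
    (f : T1 -> T2) :
  (forall i, measurable (F i)) -> (forall i, measurable_fun (F i) f) ->
  measurable_fun (\big[setU/set0]_(i <- s) F i) f.
Proof.
move=> mF mf; elim: s => [|i s IH]; first by rewrite big_nil; exact: measurable_fun_set0.
by rewrite big_cons; apply/measurable_funU => //; exact: bigsetU_measurable.
Qed.

Lemma ge0_integral_bigcup_le d (T : measurableType d) (R : realType)
    (mu : {measure set T -> \bar R}) (F : (set T)^nat) (f : T -> \bar R) :
  (forall k, measurable (F k)) -> measurable_fun (\bigcup_k F k) f ->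
  (forall x, (\bigcup_k F k) x -> (0 <= f x)%E) ->
  (\int[mu]_(x in \bigcup_k F k) f x <= \sum_(k <oo) \int[mu]_(x in F k) f x)%E.
Proof.
move=> mF mf f0; have mD := seqDU_measurable mF.
rewrite seqDU_bigcup_eq in mf f0 *.
rewrite ge0_integral_bigcup//.
apply: lee_nneseries => [k _ _|k _].
  by apply: integral_ge0 => x Dx; apply: f0; exists k.
have FD x : F k x -> (\bigcup_k seqDU F k) x.
  by rewrite -seqDU_bigcup_eq; exists k.
apply: ge0_subset_integral => //.
- by apply: measurable_funS mf => //; exact: bigcup_measurable.
- by move=> x /FD; exact: f0.
- exact: subset_seqDU.
Qed.

Section dyadic.
Context {R : realType} {d : nat}.
Variables (l0 : R) (l00 : 0 < l0).

(* corner and generation *)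
Definition node := ('rV[R]_d * nat)%type.
Definition side (n : nat) : R := l0 / 2 ^+ n.
Definition child (P : node) (b : {ffun 'I_d -> bool}) : node :=
  (P.1 + \row_i ((b i)%:R * side P.2.+1), P.2.+1).
Definition dcube (P : node) : set (euclid R d) := hcube P.1 (side P.2).
Definition quadrant (P : node) (x : 'rV[R]_d) : {ffun 'I_d -> bool} :=
  [ffun i => P.1 ord0 i + side P.2.+1 <= x ord0 i].

Lemma side_gt0 n : 0 < side n.
Proof. by rewrite divr_gt0// exprn_gt0. Qed.

Lemma sideS n : side n = side n.+1 + side n.+1.
Proof. by rewrite /side exprS; field; rewrite expf_neq0. Qed.

Lemma dcube_childP P b x : dcube (child P b) x <-> dcube P x /\ quadrant P x = b.
Proof.
have s0 := side_gt0 P.2.+1; have sS := sideS P.2.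
split=> [xb|[xP <-] i].
  split=> [i|]; last apply/ffunP => i; have := xb i; rewrite !mxE ?ffunE.
    case: (b i) => /=; rewrite ?mul1r ?mul0r => /andP[? ?];
      by apply/andP; split; lra.
  case: (b i) => /=; rewrite ?mul1r ?mul0r ?addr0; first by case/andP.
  by case/andP=> _; rewrite ltNge => /negbTE.
have := xP i; rewrite !mxE ffunE.
case: (leP (P.1 ord0 i + side P.2.+1) (x ord0 i)) => /= h;
  by rewrite ?mul1r ?mul0r => /andP[? ?]; apply/andP; split; lra.
Qed.

Lemma dcube_children P :
  dcube P = \big[setU/set0]_(b <- enum {ffun 'I_d -> bool}) dcube (child P b).
Proof.
apply/seteqP; split=> x.
  move=> xP; rewrite -bigcup_seq; exists (quadrant P x); first by rewrite /= mem_enum.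
  exact/dcube_childP.
by rewrite -bigcup_seq => -[b _ /dcube_childP[]].
Qed.

Lemma measurable_dcube P : measurable (dcube P).
Proof. exact: measurable_hcube. Qed.

(** The fixed set [X] lets the same splitting serve for pieces of a cube; [setT] gives the whole
    cube. *)
Lemma ge0_integral_children P (X : set (euclid R d)) (f : euclid R d -> \bar R) :
  measurable X ->
  measurable_fun (dcube P `&` X) f -> (forall x, (dcube P `&` X) x -> (0 <= f x)%E) ->
  (\int[lebesgue_rV]_(x in dcube P `&` X) f x =
   \sum_b \int[lebesgue_rV]_(x in dcube (child P b) `&` X) f x)%E.
Proof.
move=> mX mf f0; rewrite -[in RHS]big_enum/=.
have E : dcube P `&` X = \big[setU/set0]_(b <- enum {ffun 'I_d -> bool})
    (dcube (child P b) `&` X).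
  by rewrite dcube_children -!bigcup_seq setI_bigcupl.
rewrite E in mf f0 *; apply: ge0_integral_bigsetU => //.
- by move=> b; apply: measurableI => //; exact: measurable_dcube.
- exact: enum_uniq.
- by move=> b b' _ _ [x [[/dcube_childP[_ <-] _] [/dcube_childP[_ <-] _]]].
Qed.

Definition vol (P : node) : R := side P.2 ^+ d.

Lemma lebesgue_dcube P : lebesgue_rV (dcube P) = (vol P)%:E.
Proof. by rewrite lebesgue_hcube// side_gt0. Qed.

Lemma vol_gt0 P : 0 < vol P. Proof. by rewrite exprn_gt0// side_gt0. Qed.

Lemma vol_child P b : vol P = 2 ^+ d * vol (child P b).
Proof. by rewrite /vol -exprMn sideS mulr_natl. Qed.

Lemma vol_children P : vol P = \sum_b vol (child P b).
Proof.
rewrite (vol_child P [ffun=> true]) (eq_bigr (fun=> vol (child P [ffun=> true])))//.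
by rewrite sumr_const card_ffun card_bool card_ord -[RHS]mulr_natl natrX.
Qed.

(** * The dyadic maximal function of a weight *)

Section weight.
Variables (sg : euclid R d -> R) (s : node -> R).
Hypotheses (msg : measurable_fun setT sg) (sg0 : forall x, 0 < sg x).
Hypothesis sE : forall P, (\int[lebesgue_rV]_(x in dcube P) (sg x)%:E = (s P)%:E)%E.

Let lam P := s P / vol P.

(** The pointwise counterpart of [pathsum]: for x in the cube [P], the running maximum of the
    averages over the dyadic cubes containing x, down [N] generations and started at [m]. *)
Fixpoint pathmax (N : nat) (P : node) (m : R) (x : euclid R d) : R :=
  if N is N'.+1
  then let c := child P (quadrant P x) in pathmax N' c (Num.max m (lam c)) x
  else m.

Lemma pathmaxS N P m x : pathmax N P m x <= pathmax N.+1 P m x.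
Proof.
elim: N P m => [|N IH] P m; first by rewrite /= le_max lexx.
exact: IH.
Qed.

Lemma pathmax_ge N P m x : m <= pathmax N P m x.
Proof. by elim: N => [//|N IH]; exact: le_trans (pathmaxS _ _ _ _). Qed.

Lemma measurable_pathmax N P m :
  measurable_fun (dcube P) (pathmax N P m).
Proof.
elim: N P m => [|N IH] P m; first exact: measurable_cst.
rewrite dcube_children; apply: measurable_fun_bigsetU => b.
  exact: measurable_dcube.
apply: (eq_measurable_fun (pathmax N (child P b) (Num.max m (lam (child P b))))).
  by move=> x /set_mem/dcube_childP[_ <-].
exact: IH.
Qed.

Lemma measurable_integrand e N P m :
  measurable_fun (dcube P) (fun x : euclid R d => (sg x * pathmax N P m x `^ e)%:E).
Proof.
apply/measurable_EFinP/measurable_funM.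
  exact: measurable_funS msg.
apply: (measurableT_comp (measurable_powR _)).
exact: measurable_pathmax.
Qed.

Lemma integral_pathmax e N P m :
  (\int[lebesgue_rV]_(x in dcube P) (sg x * pathmax N P m x `^ e)%:E =
   (pathsum child lam (fun P m => m `^ e * s P) N P m)%:E)%E.
Proof.
have pos Q M k x : (0 <= (sg x * pathmax M Q k x `^ e)%:E)%E.
  by rewrite lee_fin mulr_ge0 ?powR_ge0// ltW.
elim: N P m => [|N IH] P m.
  under eq_integral do rewrite /= mulrC EFinM.
  rewrite ge0_integralZl//.
  - by rewrite sE -EFinM.
  - exact: measurable_dcube.
  - by apply/measurable_EFinP; exact: measurable_funS msg.
  - by move=> x _; rewrite lee_fin ltW.
  - by rewrite lee_fin powR_ge0.
rewrite -[dcube P]setIT ge0_integral_children//; last first.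
  by rewrite setIT; exact: measurable_integrand.
rewrite /= -sumEFin; apply: eq_bigr => b _; rewrite setIT -IH.
by apply: eq_integral => x /set_mem/dcube_childP[_ <-].
Qed.

Definition dilate (a b : 'rV[R]_d) (h : R) : set (euclid R d) :=
  box (a - const_mx h) (b + const_mx h).

(* Dyadic cubes of depth N that meet the box are contained in its dilation by
   their side, so the box need not be adapted to the dyadic grid. *)
Lemma integral_box_dilate (G : set (euclid R d)) (t : R) a b N P m :
  measurable G -> (forall x, G x -> dcube P x -> forall M, pathmax M P m x <= t) ->
  lam P <= m -> 0 <= t ->
  (\int[lebesgue_rV]_(x in dcube P `&` (G `&` box a b)) (sg x)%:E <=
   t%:E * lebesgue_rV (dcube P `&` dilate a b (side (P.2 + N))))%E.
Proof.
move=> mG + + t0.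
have mGB : measurable (G `&` (box a b : set (euclid R d))).
  by apply: measurableI => //; exact: measurable_box.
have mf X : measurable_fun X (fun x => (sg x)%:E).
  by apply/measurable_EFinP; exact: measurable_funS msg.
have f0 (X : set (euclid R d)) x : X x -> (0 <= (sg x)%:E)%E.
  by move=> _; rewrite lee_fin ltW.
elim: N P m => [|N IH] P m hG lm.
  (* A point of the piece gives lam P <= m <= t, and [P], which meets the box, lies inside the
     dilation by its own side. *)
  have [->|/set0P[x [Px [Gx xB]]]] := eqVneq (dcube P `&` (G `&` box a b)) set0.
    by rewrite integral_set0 mule_ge0// lee_fin.
  have mt : m <= t by exact: (hG x Gx Px 0%N).
  apply: (@le_trans _ _ (s P)%:E).
    rewrite -sE; apply: ge0_subset_integral => //.
    - by apply: measurableI => //; exact: measurable_dcube.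
    - exact: measurable_dcube.
    - exact: f0.
  have -> : dcube P `&` dilate a b (side (P.2 + 0)) = dcube P.
    apply/setIidl => y Py i; rewrite !mxE addn0.
    have /andP[? ?] := Px i; have /andP[? ?] := Py i; have /andP[? ?] := xB i.
    by apply/andP; split; lra.
  rewrite lebesgue_dcube -EFinM lee_fin -ler_pdivrMr ?vol_gt0//.
  exact: le_trans mt.
have mX : measurable (dilate a b (side (P.2 + N.+1))) by exact: measurable_box.
(* The right-hand side is written as an integral so that both sides split over the children. *)
rewrite -integral_cst; last by apply: measurableI => //; exact: measurable_dcube.
rewrite !ge0_integral_children//; last exact: f0.
apply: lee_sum => c _; rewrite integral_cst; last first.
  by apply: measurableI => //; exact: measurable_dcube.
rewrite addnS -addSn; apply: (IH (child P c) (Num.max m (lam (child P c)))).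
  move=> x Gx /dcube_childP[Px Pc] M; have := hG x Gx Px M.+1.
  by rewrite /= Pc.
by rewrite le_max lexx orbT.
Qed.

(** The depth in [integral_box_dilate] tends to infinity, and the dilated volume is dominated by
    [V N], which tends to the volume of the box, even when the box is empty. *)
Lemma integral_box_le (G : set (euclid R d)) (t : R) a b P m :
  measurable G -> (forall x, G x -> dcube P x -> forall M, pathmax M P m x <= t) ->
  lam P <= m -> 0 <= t ->
  (\int[lebesgue_rV]_(x in dcube P `&` (G `&` box a b)) (sg x)%:E <=
   (t * box_volume a b)%:E)%E.
Proof.
move=> mG hG lm t0.
pose h N := side (P.2 + N).
have h0 : h @ \oo --> 0.
  have -> : h = geometric (side P.2) 2^-1.
    by apply/funext => N; rewrite /h /side /geometric/= exprD exprVn invfM mulrA.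
  by apply: cvg_geometric; rewrite ger0_norm ?invr_ge0// invf_lt1// ltr1n.
pose V N := \prod_(i < d) (Num.max 0 (b ord0 i - a ord0 i) + 2 * h N).
have cV : V @ \oo --> box_volume a b.
  apply: cvg_big => [|i _]; first exact: mul_continuous.
  rewrite -[X in _ --> X]addr0; apply: cvgD; first exact: cvg_cst.
  by rewrite -[X in _ --> X](mulr0 2); apply: cvgM => //; exact: cvg_cst.
have cT : (t * V N)%:E @[N --> \oo] --> (t * box_volume a b)%:E.
  apply/fine_cvgP; split; first by apply: nearW.
  by apply: cvgM => //; exact: cvg_cst.
apply: (cvge_to_ge cT).
apply: nearW => N.
apply: (le_trans (@integral_box_dilate G t a b N P m mG hG lm t0)).
rewrite EFinM lee_wpmul2l ?lee_fin//.
apply: (@le_trans _ _ (lebesgue_rV (dilate a b (h N)))).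
  by apply: le_lebesgue_outer; exact: subIsetr.
rewrite lebesgue_box lee_fin; apply: ler_prod => i _.
rewrite !mxE le_max lexx/= /Num.max.
have := side_gt0 (P.2 + N); rewrite -/(h N).
by do !case: ifPn => //; lra.
Qed.

(** The measure of [G] is an infimum over box covers, and the bound for a single box sums over each
    cover. *)
Lemma integral_le_lebesgue (G : set (euclid R d)) (t : R) P m :
  measurable G -> G `<=` dcube P -> (forall x, G x -> forall M, pathmax M P m x <= t) ->
  lam P <= m -> 0 < t ->
  (\int[lebesgue_rV]_(x in G) (sg x)%:E <= t%:E * lebesgue_rV G)%E.
Proof.
move=> mG GP hG lm t0; rewrite -lee_pdivrMl//.
apply: le_ereal_inf_tmp => _ [S [cS GS] <-].
have [K [e [Ke eE]]] := @countable_esum_seq R _ (0 : 'rV[R]_d, 0 : 'rV[R]_d) S cS.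
rewrite (eE (fun ab => box_volume ab.1 ab.2)) => [|ab]; last exact: box_volume_ge0.
rewrite lee_pdivrMl// -nneseriesZl; last first.
  by move=> k _; rewrite lee_fin mulr_ge0// box_volume_ge0.
pose F k := dcube P `&` (G `&` (if k \in K then box (e k).1 (e k).2 else set0)).
have mF k : measurable (F k).
  apply: measurableI; first exact: measurable_dcube.
  by apply: measurableI => //; case: ifP => // _; exact: measurable_box.
have -> : G = \bigcup_k F k.
  apply/seteqP; split=> [x Gx|x [k _ [_ []//]]].
  have [ab /Ke[k Kk <-] xab] := GS x Gx.
  by exists k => //; split; [exact: GP|split=> //; rewrite mem_set].
apply: le_trans.
  apply: ge0_integral_bigcup_le => //.
    by apply/measurable_EFinP; exact: measurable_funS msg.
  by move=> x _; rewrite lee_fin ltW.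
apply: lee_nneseries => [k _ _|k _].
  by apply: integral_ge0 => x _; rewrite lee_fin ltW.
rewrite -EFinM /F indicE; case: ifP => _; rewrite ?mul1r ?mul0r.
  by apply: (integral_box_le _ _ mG _ lm (ltW t0)) => x Gx _; exact: hG.
by rewrite !setI0 integral_set0 mulr0.
Qed.

Hypothesis s0 : forall P, 0 < s P.

(** On the set where every [pathmax] is at most q but [sg] is at least q + 1/(k+1), the integral of
    [sg] is at most q times the measure by [integral_le_lebesgue], so the set is null. Rational q
    and natural k leave countably many such sets. *)
Lemma ae_le_pathmax P : \forall x \ae (@lebesgue_rV R d), dcube P x ->
  forall q : rat, (forall N, pathmax N P (lam P) x <= ratr q) -> sg x <= ratr q.
Proof.
pose L q (x : euclid R d) := forall N, pathmax N P (lam P) x <= ratr q.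
suff H q k : \forall x \ae (@lebesgue_rV R d),
    ~ [/\ dcube P x, L q x & ratr q + k.+1%:R^-1 <= sg x].
  have H2 n k : \forall x \ae (@lebesgue_rV R d),
      if (unpickle n : option rat) is Some q
      then ~ [/\ dcube P x, L q x & ratr q + k.+1%:R^-1 <= sg x] else True.
    case: (unpickle n) => [q|]; first exact: H.
    exact: nearW.
  apply: filterS (ae_foralln (fun n => ae_foralln (H2 n))) => x Hx Px q Lq.
  rewrite leNgt; apply/negP => qs.
  have [k kq] : exists k : nat, k.+1%:R^-1 < sg x - ratr q.
    have sq : 0 < sg x - ratr q by rewrite subr_gt0.
    have := near_infty_natSinv_lt (PosNum sq).
    by move=> [k _ /(_ k (leqnn k))]; exists k.
  have := Hx (pickle q) k; rewrite pickleK; apply; split=> //.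
  by rewrite -lerBrDl ltW.
(* The cube is repeated inside the intersection because [pathmax] is known to be measurable only on
   it. *)
pose G := dcube P `&` (\bigcap_N (dcube P `&` [set x | pathmax N P (lam P) x <= ratr q]))
   `&` [set x | ratr q + k.+1%:R^-1 <= sg x].
have mG : measurable G.
  apply: measurableI.
    apply: measurableI; first exact: measurable_dcube.
    apply: bigcap_measurable => // N _.
    have := measurable_pathmax N (lam P) (measurable_dcube P) (measurable_itv `]-oo, ratr q]).
    by rewrite [X in _ `&` X](_ : _ = [set x | pathmax N P (lam P) x <= ratr q])//
      set_itvE.
  rewrite -[X in measurable X]setTI.
  have := msg measurableT (measurable_itv `[ratr q + k.+1%:R^-1, +oo[).
  by rewrite [X in _ `&` X](_ : _ = [set x | ratr q + k.+1%:R^-1 <= sg x])// set_itvE.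
exists G; split=> //; last first.
  by move=> x /contrapT[Px Lx sx]; split=> //; split=> // N _; split=> //; exact: Lx.
have [->|/set0P[x [[Px Lx] _]]] := eqVneq G set0; first exact: measure0.
(* At depth zero [pathmax] is the positive average [lam P]. *)
have q0 : 0 < ratr q :> R.
  by apply: lt_le_trans (Lx 0%N I).2; rewrite divr_gt0// vol_gt0.
have GP : G `<=` dcube P by move=> y [[]].
have h1 : (\int[lebesgue_rV]_(x in G) (sg x)%:E <= (ratr q)%:E * lebesgue_rV G)%E.
  apply: (@integral_le_lebesgue G (ratr q) P (lam P)) => // y [[_ Ly] _] M.
  exact: (Ly M I).2.
have h2 : ((ratr q + k.+1%:R^-1)%:E * lebesgue_rV G <= \int[lebesgue_rV]_(x in G) (sg x)%:E)%E.
  rewrite -integral_cst//; apply: ge0_le_integral => //.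
  - by move=> y _; rewrite lee_fin addr_ge0// ltW.
  - by apply/measurable_EFinP; exact: measurable_funS msg.
  - by move=> y [_]; rewrite lee_fin.
have := le_trans h2 h1.
have : (lebesgue_rV G <= (vol P)%:E)%E by rewrite -lebesgue_dcube; exact: le_lebesgue_outer.
have : (0 <= lebesgue_rV G)%E by exact: lebesgue_outer_ge0.
case: (lebesgue_rV G) => // r; rewrite -!EFinM !lee_fin => r0 _ h.
congr EFin; apply/eqP; rewrite eq_le r0 andbT.
rewrite mulrDl gerDl in h.
by rewrite -(@pmulr_rle0 _ (k.+1%:R^-1)).
Qed.

(** Monotone convergence carries the bounds at finite depth to the limit of the [pathmax], which
    dominates [sg] almost everywhere. *)
Lemma weight_reverse_hoelder (e K : R) P : 0 < e ->
  (forall N, pathsum child lam (fun P m => m `^ e * s P) N P (lam P) <= K) ->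
  (\int[lebesgue_rV]_(x in dcube P) (sg x * sg x `^ e)%:E <= K%:E)%E.
Proof.
move=> e0 hK.
pose f N x : \bar R := (sg x * pathmax N P (lam P) x `^ e)%:E.
have lam0 : 0 < lam P by rewrite divr_gt0// vol_gt0.
have pm0 N x : 0 < pathmax N P (lam P) x.
  exact: lt_le_trans (pathmax_ge _ _ _ _).
have f0 N x : (0 <= f N x)%E by rewrite lee_fin mulr_ge0 ?powR_ge0// ltW.
have ndf x : nondecreasing_seq (f ^~ x).
  apply/nondecreasing_seqP => N; rewrite lee_fin ler_pM2l//.
  by apply: ge0_ler_powR; rewrite ?nnegrE ?pathmaxS// ltW.
have cf x : f ^~ x @ \oo --> ereal_sup (range (f ^~ x)).
  exact: ereal_nondecreasing_cvgn.
have mf N : measurable_fun (dcube P) (f N) by exact: measurable_integrand.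
have mD := measurable_dcube P.
have flim x : limn (f ^~ x) = ereal_sup (range (f ^~ x)) by apply: cvg_lim.
apply: (@le_trans _ _ (\int[lebesgue_rV]_(x in dcube P) limn (f ^~ x))%E); last first.
  have ndfT x : dcube P x -> {homo f ^~ x : n m / (n <= m)%N >-> (n <= m)%E}.
    by move=> _; exact: ndf.
  have C := @cvg_monotone_convergence _ _ _ lebesgue_rV _ mD f mf (fun N x _ => f0 N x) ndfT.
  apply: (cvge_to_le C); apply: nearW => N.
  by rewrite /f integral_pathmax lee_fin.
apply: ae_ge0_le_integral.
- exact: mD.
- by move=> x _; rewrite lee_fin mulr_ge0 ?powR_ge0// ltW.
- apply/measurable_EFinP/measurable_funM; first exact: measurable_funS msg.
  by apply: (measurableT_comp (measurable_powR _)); exact: measurable_funS msg.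
- move=> x _; rewrite flim; apply: le_trans (f0 0%N x) _.
  by apply: ereal_sup_ubound; exists 0%N.
- by apply: (emeasurable_fun_cvg f) => // x _; rewrite flim.
apply: filterS (ae_le_pathmax P) => x Hx Px; rewrite flim leNgt; apply/negP => lt.
have ub N : (f N x < (sg x * sg x `^ e)%:E)%E.
  by apply: le_lt_trans lt; apply: ereal_sup_ubound; exists N.
have fin : ereal_sup (range (f ^~ x)) \is a fin_num.
  rewrite ge0_fin_numE; first exact: lt_trans lt (ltry _).
  by apply: le_trans (f0 0%N x) _; apply: ereal_sup_ubound; exists 0%N.
pose y := fine (ereal_sup (range (f ^~ x))).
have yE : ereal_sup (range (f ^~ x)) = y%:E by rewrite fineK.
have fy N : sg x * pathmax N P (lam P) x `^ e <= y.
  by rewrite -lee_fin -yE; apply: ereal_sup_ubound; exists N.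
have y0 : 0 <= y by apply: le_trans (fy 0%N); rewrite mulr_ge0 ?powR_ge0// ltW.
rewrite yE lte_fin mulrC -ltr_pdivrMr// in lt.
(* Were the limit [y] smaller than sg^(1+e), this [z] would bound every [pathmax] and be smaller
   than [sg x]; a rational between them contradicts [Hx]. *)
pose z := (y / sg x) `^ e^-1.
have ze : z `^ e = y / sg x.
  by rewrite -powRrM mulVf ?gt_eqF// powRr1// divr_ge0// ltW.
have zs : z < sg x.
  rewrite ltNge; apply/negP => sz; move: lt; rewrite -ze ltNge => /negP; apply.
  by apply: ge0_ler_powR; rewrite ?nnegrE ?powR_ge0// ltW.
have [q] := rat_in_itvoo zs; rewrite in_itv/= => /andP[zq qs].
suff : sg x <= ratr q by rewrite leNgt qs.
apply: (Hx Px) => N; apply: le_trans (ltW zq).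
have := fy N; rewrite mulrC -ler_pdivlMr// -ze => h.
rewrite leNgt; apply/negP => zp; move: h; rewrite leNgt => /negP; apply.
by apply: gt0_ltr_powR; rewrite ?nnegrE ?powR_ge0// ltW.
Qed.

End weight.
End dyadic.

(** * Numerical bounds *)

Section numeric.
Context {R : realType}.

Lemma series_exp_coeff_le_expR (x : R) n : 0 <= x ->
  \sum_(0 <= k < n) x ^+ k / k`!%:R <= expR x.
Proof.
move=> x0; apply: (@nondecreasing_cvgn_le _ (series (exp_coeff x))).
  apply/nondecreasing_seqP => k; rewrite /series/= big_nat_recr//= lerDl.
  by rewrite /exp_coeff/= divr_ge0// exprn_ge0.
exact: is_cvg_series_exp_coeff.
Qed.

(* The final estimate reads e^(1/(2e)) <= 4 (1 - ln 2), that is 1.202 <= 1.227,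
   which dictates the precision of the next three bounds. *)
Lemma ln2_le : ln (2 : R) <= 139 / 200.
Proof.
rewrite -ler_expR lnK ?posrE//.
have x0 : 0 <= 139 / 200 :> R by lra.
apply: le_trans (series_exp_coeff_le_expR 5 x0).
rewrite !big_nat_recr//= big_nil !factS fact0 !exprS expr0 /=.
lra.
Qed.

Lemma expR1_ge : 27 / 10 <= expR (1 : R).
Proof.
apply: le_trans (series_exp_coeff_le_expR 5 ler01).
rewrite !big_nat_recr//= big_nil !factS fact0 !expr1n /=.
lra.
Qed.

(** Since ln t <= t / exp 1 and e t <= 1/2, the exponent e ln t is at most 5/27. The target 61/50 is
    4 (1 - 139/200). *)
Lemma powR_le_61div50 (t e : R) : 0 < t -> 0 <= e -> e * (2 * t) <= 1 ->
  t `^ e <= 61 / 50.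
Proof.
move=> t0 e0 et.
have hln : ln t <= t * (10 / 27).
  have := expR_ge1Dx (ln t - 1); rewrite addrC subrK expRD lnK ?posrE//.
  rewrite expRN => h; apply: (le_trans h).
  rewrite ler_pM2l// -[10 / 27]invf_div lef_pV2 ?posrE ?expR_gt0//.
  exact: expR1_ge.
have hx : e * ln t <= 5 / 27.
  apply: (le_trans (ler_wpM2l e0 hln)); lra.
rewrite /powR gt_eqF//.
apply: (@le_trans _ _ (expR (5 / 27))); first by rewrite ler_expR.
(* The tangent bound is applied at half the exponent and squared: (49/54)^2 exceeds 50/61, while 1 -
   5/27 does not. *)
have h1 := expR_ge1Dx (- (5 / 54) : R).
rewrite -[leLHS]invrK -expRN (_ : - (5 / 27) = - (5 / 54) + - (5 / 54) :> R); last by field.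
rewrite expRD -[leRHS]invrK lef_pV2 ?posrE; [|by rewrite mulr_gt0 ?expR_gt0|lra].
have h0 : 49 / 54 <= expR (- (5 / 54)) :> R by lra.
have p0 : 0 <= 49 / 54 :> R by lra.
apply: (le_trans _ (ler_pM p0 p0 h0 h0)); lra.
Qed.

(* concavity of the logarithm on [2^-d, 1] *)
Lemma ln_le_dyadic (d : nat) (L y : R) : (1 <= d)%N -> ln 2 <= L ->
  1 <= y -> y <= 2 ^+ d -> ln y <= 2 ^+ d * L * (1 - y^-1).
Proof.
move=> d1 hL y1 yD; set D : R := 2 ^+ d.
have D2 : 2 <= D by rewrite /D -{1}(expr1 2) ler_eXn2l// ltr1n.
have dD : d%:R <= D - 1.
  rewrite lerBrDr natr1 /D -natrX ler_nat; exact: ltn_expl.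
have y0 : 0 < y by lra.
have D0 : 0 < D by lra.
have yi1 : y^-1 <= 1 by rewrite invf_le1.
have Di : D^-1 <= y^-1 by rewrite lef_pV2 ?posrE.
have Di1 : D^-1 < 1 by rewrite invf_lt1//; lra.
(* With this weight 1/y = th/D + (1 - th), so concavity yields ln y <= th ln D = th d ln 2; then
   [dD] replaces d by D - 1. *)
pose th := (1 - y^-1) / (1 - D^-1).
have th0 : 0 <= th by rewrite divr_ge0 ?subr_ge0// ltW.
have th1 : th <= 1 by rewrite ler_pdivrMr ?subr_gt0// mul1r; lra.
have Dip : 0 < D^-1 by rewrite invr_gt0.
have := @concave_ln R (Itv01 th0 th1) D^-1 1 Dip ltr01.
rewrite !convRE/= ln1 mulr0 addr0.
have -> : th * D^-1 + (1 - th) * 1 = y^-1.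
  by rewrite /th; field; rewrite !gt_eqF//; lra.
rewrite !lnV ?posrE// mulrN lerN2 => h; apply: (le_trans h).
have lnD : ln D = d%:R * ln 2 by rewrite /D lnXn// mulr_natl.
rewrite lnD mulrC.
have -> : th = D / (D - 1) * (1 - y^-1).
  by rewrite /th; field; rewrite !gt_eqF//; lra.
rewrite mulrA ler_wpM2r ?subr_ge0// mulrCA ler_wpM2l ?(ltW D0)//.
have ln20 : 0 <= ln 2 :> R by rewrite ln_ge0// ler1n.
have D10 : 0 <= D - 1 by lra.
have := ler_wpM2r ln20 dD; have := ler_wpM2l D10 hL.
rewrite ler_pdivrMr; lra.
Qed.

End numeric.

(** * Muckenhoupt weights *)

Section Ap.
Context {R : realType} {d : nat}.
Local Notation mu := (@lebesgue_rV R d).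

Lemma integral_hcube_gt0 (f : euclid R d -> R) a l : 0 < l ->
  measurable_fun setT f -> (forall x, 0 < f x) ->
  (0 < \int[mu]_(x in hcube a l) (f x)%:E)%E.
Proof.
move=> l0 mf f0; rewrite lt_neqAle; apply/andP; split; last first.
  by apply: integral_ge0 => x _; rewrite lee_fin ltW.
apply/negP => /eqP/esym E.
have mh := measurable_hcube a l.
have mfh : measurable_fun (hcube a l) (fun x => (f x)%:E).
  by apply/measurable_EFinP; exact: measurable_funS mf.
have /(ae_eq_integral_abs mu mh mfh) : (\int[mu]_(x in hcube a l) `|(f x)%:E| = 0)%E.
  by rewrite -[RHS]E; apply: eq_integral => x _; rewrite gee0_abs// lee_fin ltW.
move=> [N [mN N0 hN]].
have : (mu (hcube a l) <= mu N)%E.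
  apply: le_lebesgue_outer => x hx; apply: hN => /(_ hx)/eqP.
  by rewrite eqe gt_eqF.
by rewrite [X in (_ <= X)%E -> _]N0 lebesgue_hcube// lee_fin leNgt exprn_gt0.
Qed.

Lemma average_cbox (f : 'rV[R]_d -> R) a l : 0 < l ->
  measurable_fun setT (f : euclid R d -> R) -> (forall x, 0 < f x) ->
  average (cbox a l) f =
    (((l ^+ d)^-1)%:E * \int[mu]_(x in hcube a l) (f x)%:E)%E.
Proof.
move=> l0 mf f0; rewrite /average lebesgue_cbox// inver gt_eqF ?exprn_gt0//.
congr (_ * _)%E; apply: ge0_integral_cbox_hcube; first exact/measurable_EFinP.
by move=> x; rewrite lee_fin ltW.
Qed.

Lemma compact_cbox (a : 'rV[R]_d) l : compact (cbox a l : set 'rV[R]_d).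
Proof.
have := @rV_compact R d (fun i => `[a ord0 i, (a + const_mx l) ord0 i]%classic)
  (fun i => @segment_compact R _ _).
by congr compact; apply/seteqP; split=> x xa i; have := xa i; rewrite /= in_itv.
Qed.

Variables (beta : R) (w : 'rV[R]_d -> R).
Hypotheses (hbeta : 1 < beta) (hw : Ap_weight beta w).

Let A := fine (Ap_char beta w).
Let q1 := (beta - 1)^-1.
Definition dual_weight (x : 'rV[R]_d) : R := w x `^ (- (1 / (beta - 1))).
Local Notation sg := dual_weight.

Lemma w_gt0 x : 0 < w x. Proof. exact: hw.1.2. Qed.
Lemma dual_weight_gt0 x : 0 < sg x. Proof. by rewrite powR_gt0 ?w_gt0. Qed.
Lemma measurable_w : measurable_fun setT (w : euclid R d -> R).
Proof. exact: hw.1.1.1. Qed.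
Lemma measurable_dual_weight : measurable_fun setT (sg : euclid R d -> R).
Proof. exact: (measurableT_comp (measurable_powR _) measurable_w). Qed.

(** Local integrability on the compact closed cube makes the mass of [w] finite. The mass of the
    dual weight is then finite too, since otherwise the A_beta product would be infinite. *)
Lemma Ap_hcube a l : 0 < l -> exists W S : R, [/\ 0 < W, 0 < S,
  (\int[mu]_(x in hcube a l) (w x)%:E)%E = W%:E,
  (\int[mu]_(x in hcube a l) (sg x)%:E)%E = S%:E &
  W / l ^+ d * (S / l ^+ d) `^ (beta - 1) <= A].
Proof.
move=> l0; have ld0 : 0 < l ^+ d by rewrite exprn_gt0.
have mh := measurable_hcube a l.
have b10 : 0 < beta - 1 by rewrite subr_gt0.
have W0 := integral_hcube_gt0 a l0 measurable_w w_gt0.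
have S0 := integral_hcube_gt0 a l0 measurable_dual_weight dual_weight_gt0.
have Woo : (\int[mu]_(x in hcube a l) (w x)%:E < +oo)%E.
  apply: le_lt_trans (hw.1.1.2 _ (@compact_cbox a l)).
  rewrite -ge0_integral_cbox_hcube; [|exact/measurable_EFinP/measurable_w|]; last first.
    by move=> x; rewrite lee_fin ltW// w_gt0.
  rewrite le_eqVlt; apply/orP; left; apply/eqP; apply: eq_integral => x _.
  by rewrite ger0_norm// ltW// w_gt0.
have hA : (average (cbox a l) w * average (cbox a l) sg `^ (beta - 1) <=
    Ap_char beta w)%E.
  by apply: ereal_sup_ubound; exists (cbox a l) => //; exists a, l.
rewrite !average_cbox// in hA; try exact: measurable_dual_weight; try exact: measurable_w;
  try exact: w_gt0; try exact: dual_weight_gt0.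
move: W0 S0 Woo hA.
case: (\int[mu]_(x in hcube a l) (w x)%:E)%E => // W W0 + _.
case: (\int[mu]_(x in hcube a l) (sg x)%:E)%E => // [S S0|_].
  rewrite -!EFinM => hA.
  exists W, S; split=> //.
  rewrite ![_ / l ^+ d]mulrC -lee_fin fineK// fin_numElt hw.2 andbT.
  exact: lt_le_trans (ltNyr _) hA.
rewrite gt0_muley ?lte_fin ?invr_gt0// poweRyr ?gt_eqF// gt0_muley; last first.
  by rewrite -EFinM lte_fin mulr_gt0 ?invr_gt0.
by rewrite leye_eq => /eqP E; have := hw.2; rewrite E.
Qed.

Lemma Ap_gt0 : 0 < A.
Proof.
have [W [S [W0 S0 _ _ h]]] := Ap_hcube 0 (@ltr01 R).
apply: lt_le_trans h; rewrite expr1n !divr1.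
by rewrite mulr_gt0// powR_gt0.
Qed.

Lemma beta_q1 : beta * q1 = q1 + 1.
Proof. by rewrite /q1; field; rewrite subr_eq0 gt_eqF. Qed.

Lemma q1_gt0 : 0 < q1. Proof. by rewrite invr_gt0 subr_gt0. Qed.

(** Young's inequality for [f] and 1/w, multiplied by (q1 + 1) w. *)
Lemma dual_young (f : R) x : 0 < f ->
  (q1 + 1) * f `^ q1 <= sg x + q1 * (f * f `^ q1) * w x.
Proof.
move=> f0; have w0 := w_gt0 x.
have wi : 0 <= (w x)^-1 by rewrite invr_ge0 ltW.
have := powR_young hbeta beta_q1 (ltW f0) wi.
have -> : sg x = (w x)^-1 `^ q1.
  by rewrite /sg mul1r -/q1 -mulN1r powRrM powR_inv1// ltW.
set X := (w x)^-1 `^ q1; set Y := f `^ q1 => h.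
have qw : 0 <= (q1 + 1) * w x by rewrite mulr_ge0 ?addr_ge0// ?ltW// q1_gt0.
have := ler_wpM2l qw h.
have q10 := q1_gt0; have q1n : q1 + 1 != 0 by rewrite gt_eqF// addr_gt0.
have b0 : beta != 0 by rewrite gt_eqF// (lt_trans ltr01).
have -> : (q1 + 1) * w x * (Y * (w x)^-1) = (q1 + 1) * Y.
  by field; rewrite gt_eqF.
have -> : (q1 + 1) * w x * (f * Y / beta + (w x)^-1 * X / (q1 + 1)) =
   X + (q1 + 1) / beta * (f * Y) * w x by field; rewrite b0 q1n gt_eqF.
by rewrite (_ : (q1 + 1) / beta = q1)// -beta_q1 mulrAC divff// mul1r.
Qed.

Lemma dual_hoelder a l W S : 0 < l -> 0 < W ->
  (\int[mu]_(x in hcube a l) (w x)%:E)%E = W%:E ->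
  (\int[mu]_(x in hcube a l) (sg x)%:E)%E = S%:E ->
  (l ^+ d / W) `^ q1 * l ^+ d <= S.
Proof.
move=> l0 W0 WE SE; have ld0 : 0 < l ^+ d by rewrite exprn_gt0.
have f0 : 0 < l ^+ d / W by rewrite divr_gt0.
(* With this [f] one has f W = l^d, so integrating [dual_young] leaves q1 f^q1 l^d on both sides and
   the terms cancel. *)
set f := l ^+ d / W in f0 *.
have q10 := q1_gt0.
have mh := measurable_hcube a l.
have mw : measurable_fun (hcube a l) (fun x => (w x)%:E).
  by apply/measurable_EFinP; exact: measurable_funS measurable_w.
have ms : measurable_fun (hcube a l) (fun x => (sg x)%:E).
  by apply/measurable_EFinP; exact: measurable_funS measurable_dual_weight.
have c0 : 0 <= q1 * (f * f `^ q1).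
  by apply: mulr_ge0; [exact: ltW|apply: mulr_ge0; [exact: ltW|exact: powR_ge0]].
have mcw : measurable_fun (hcube a l) (fun x => ((q1 * (f * f `^ q1))%:E * (w x)%:E)%E).
  exact: measurable_funeM.
have sg0 (x : euclid R d) : (0 <= (sg x)%:E)%E by rewrite lee_fin; exact/ltW/dual_weight_gt0.
have w0 (x : euclid R d) : (0 <= (w x)%:E)%E by rewrite lee_fin; exact/ltW/w_gt0.
have : (\int[mu]_(x in hcube a l) ((q1 + 1) * f `^ q1)%:E <=
    \int[mu]_(x in hcube a l) ((sg x)%:E + (q1 * (f * f `^ q1))%:E * (w x)%:E))%E.
  apply: ge0_le_integral.
  - exact: mh.
  - by move=> x _; rewrite lee_fin mulr_ge0 ?powR_ge0// addr_ge0// ltW.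
  - exact: measurable_cst.
  - exact: emeasurable_funD.
  - by move=> x _; rewrite -EFinM -EFinD lee_fin dual_young.
rewrite integral_cst// ge0_integralD//; last by move=> x _; rewrite mule_ge0.
rewrite ge0_integralZl// WE SE [X in (_ * X <= _)%E]lebesgue_hcube// -!EFinM -EFinD lee_fin.
have -> : q1 * (f * f `^ q1) * W = q1 * (f `^ q1 * l ^+ d).
  by rewrite /f; field; rewrite gt_eqF.
lra.
Qed.

Lemma dual_reverse_hoelder a l e S : (0 < d)%N -> 0 < l -> 0 < e ->
  e * 2 ^+ d * (beta `^ q1 * A `^ q1) <= 1 ->
  (\int[mu]_(x in hcube a l) (sg x)%:E)%E = S%:E ->
  (\int[mu]_(x in hcube a l) (sg x * sg x `^ e)%:E <=
   ((1 - 139 / 200)^-1 * ((S / l ^+ d) `^ e * S))%:E)%E.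
Proof.
move=> d0 l0 e0 he SE.
pose s P := fine (\int[mu]_(x in dcube l P) (sg x)%:E)%E.
pose wt P := fine (\int[mu]_(x in dcube l P) (w x)%:E)%E.
have H P : [/\ 0 < s P, 0 < wt P,
    (\int[mu]_(x in dcube l P) (w x)%:E)%E = (wt P)%:E,
    (\int[mu]_(x in dcube l P) (sg x)%:E)%E = (s P)%:E &
    wt P / vol l P * (s P / vol l P) `^ (beta - 1) <= A].
  have [W [S' [W0 S0 WE S'E h]]] := Ap_hcube P.1 (side_gt0 l0 P.2).
  by rewrite /s /wt /dcube WE S'E.
have s0 P : 0 < s P by case: (H P).
have w0 P : 0 < wt P by case: (H P).
have wE P : (\int[mu]_(x in dcube l P) (w x)%:E)%E = (wt P)%:E by case: (H P).
have sE P : (\int[mu]_(x in dcube l P) (sg x)%:E)%E = (s P)%:E by case: (H P).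
have v0 := @vol_gt0 R d l l0.
have children (f : euclid R d -> R) (F : node -> R) :
    measurable_fun setT f -> (forall x, 0 < f x) ->
    (forall P, (\int[mu]_(x in dcube l P) (f x)%:E)%E = (F P)%:E) ->
    forall P, F P = \sum_b F (child l P b).
  move=> mf f0 FE P; apply/EFin_inj; rewrite -sumEFin -FE.
  rewrite -[dcube l P]setIT ge0_integral_children//.
  - by apply: eq_bigr => b _; rewrite setIT FE.
  - by apply/measurable_EFinP; exact: measurable_funS mf.
  - by move=> x _; rewrite lee_fin ltW.
have key N : pathsum (child l) (fun P => s P / vol l P)
    (fun P m => m `^ e * s P) N (a, 0%N) (s (a, 0%N) / vol l (a, 0%N)) <=
    (1 - 139 / 200)^-1 * ((s (a, 0%N) / vol l (a, 0%N)) `^ e * s (a, 0%N)).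
  have b0 : 0 < beta - 1 by rewrite subr_gt0.
  apply: (@tree_reverse_hoelder R node _ (child l) (vol l) s wt beta q1
    (A `^ q1) (2 ^+ d)).
  - exact: v0.
  - exact: s0.
  - exact: w0.
  - exact: vol_children.
  - exact: children measurable_dual_weight dual_weight_gt0 sE.
  - exact: children measurable_w w_gt0 wE.
  - exact: vol_child.
  - exact: hbeta.
  - exact: beta_q1.
  - move=> P; apply: dual_hoelder (wE P) (sE P) => //; exact: side_gt0.
  - move=> P; have [_ _ _ _ h] := H P.
    have wv0 : 0 < wt P / vol l P by rewrite divr_gt0.
    have sv0 : 0 < s P / vol l P by rewrite divr_gt0.
    have q10 := q1_gt0.
    (* The A_beta inequality is raised to the power 1/(beta-1), which turns the factor of the dual
       weight into its plain average. *)
    have : (wt P / vol l P * (s P / vol l P) `^ (beta - 1)) `^ q1 <= A `^ q1.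
      apply: ge0_ler_powR => //; rewrite ?nnegrE; first exact: ltW.
        by rewrite mulr_ge0 ?powR_ge0// ltW.
      exact: ltW Ap_gt0.
    rewrite (powRM _ (ltW wv0) (powR_ge0 _ _)) -powRrM /q1 mulfV ?gt_eqF// -/q1.
    rewrite powRr1 ?(ltW sv0)// => h'.
    have m1 : (vol l P / wt P) `^ q1 * (wt P / vol l P) `^ q1 = 1.
      rewrite -powRM ?divr_ge0 ?ltW//.
      rewrite (_ : vol l P / wt P * (wt P / vol l P) = 1) ?powR1//.
      by field; rewrite !gt_eqF.
    by rewrite -[leLHS]mul1r -m1 -mulrA [leRHS]mulrC ler_wpM2l ?powR_ge0.
  - by rewrite exprn_gt0.
  - lra.
  - lra.
  - exact: ltW.
  - exact: powR_ge0.
  - by move=> y y1 y2; apply: ln_le_dyadic => //; exact: ln2_le.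
  - exact: he.
have sd0 : side l 0 = l by rewrite /side expr0 divr1.
have := weight_reverse_hoelder l0 measurable_dual_weight dual_weight_gt0 sE s0 e0 key.
have -> : dcube l (a, 0%N) = hcube a l by rewrite /dcube/= sd0.
have -> : s (a, 0%N) = S by rewrite /s /dcube/= sd0 SE.
by rewrite /vol/= sd0.
Qed.

End Ap.

(** * From the reverse Hoelder inequality to the A_r bound *)

Lemma reverse_hoelder_exponent (R : realType) (beta M : R) : 1 < beta -> 0 < M ->
  let r := beta * (1 + M) / (beta + M) in
  [/\ 1 < r, r < beta, 1 / (r - 1) = (beta - 1)^-1 * (1 + beta / M) &
      (r - 1) * (beta - 1)^-1 * (1 + beta / M) = 1].
Proof.
move=> b1 M0 r; have bM : 0 < beta + M by lra.
have nz : [/\ beta + M != 0, M != 0 & beta - 1 != 0].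
  by rewrite !gt_eqF// subr_gt0.
case: nz => n1 n2 n3.
have rE : r - 1 = (beta - 1) * M / (beta + M) by rewrite /r; field.
have r0 : 0 < r - 1 by rewrite rE divr_gt0// mulr_gt0// subr_gt0.
split.
- by rewrite -subr_gt0.
- rewrite /r ltr_pdivrMr// ltr_pM2l//; lra.
- by rewrite rE; field; rewrite n1 n2 n3.
- by rewrite rE; field; rewrite n1 n2 n3.
Qed.

Section improvement.
Context {R : realType} {d : nat}.
Variables (beta r e : R) (w : 'rV[R]_d -> R).
Hypotheses (hd : (0 < d)%N) (hbeta : 1 < beta) (hw : Ap_weight beta w).
Let A := fine (Ap_char beta w).
Let q1 := (beta - 1)^-1.
Hypotheses (r1 : 1 < r) (e0 : 0 < e) (hr : 1 / (r - 1) = q1 * (1 + e)).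
Hypothesis he : e * 2 ^+ d * (beta `^ q1 * A `^ q1) <= 1.

(** By [hr], w^(-1/(r-1)) is the power 1 + e of the dual weight, so its average is at most k
    y^(1+e). Raising this to r - 1 gives k^(r-1) y^(beta-1), and the A_beta bound applies. *)
Lemma Ap_char_improve :
  (Ap_char r w <= (((61 / 200)^-1) `^ (r - 1) * A)%:E)%E.
Proof.
have b0 : 0 < beta - 1 by rewrite subr_gt0.
have r0 : 0 < r - 1 by rewrite subr_gt0.
apply: ge_ereal_sup => _ [_ [a [l [l0 ->]]] <-].
have ld0 : 0 < l ^+ d by rewrite exprn_gt0.
have [W [S [W0 S0 WE SE h]]] := Ap_hcube hbeta hw a l0.
have S1 : 0 < S / l ^+ d by rewrite divr_gt0.
have W1 : 0 < W / l ^+ d by rewrite divr_gt0.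
have w0 := w_gt0 hw.
rewrite -/(cbox a l) (average_cbox a l0 (measurable_w hw) w0).
have mr := measurableT_comp (measurable_powR (- (1 / (r - 1)))) (measurable_w hw).
rewrite (average_cbox a l0 mr) => [|x]; last by rewrite powR_gt0.
rewrite WE.
have := dual_reverse_hoelder hbeta hw hd l0 e0 he SE.
rewrite (eq_integral (fun x : euclid R d => (w x `^ (- (1 / (r - 1))))%:E)); last first.
  move=> x _; congr EFin; rewrite /dual_weight.
  rewrite -powRrM -powRD ?(gt_eqF (w0 x)) ?implybT//; congr powR.
  by rewrite hr /q1; ring.
have : (0 <= \int[lebesgue_rV]_(x in hcube a l) (w x `^ (- (1 / (r - 1))))%:E)%E.
  by apply: integral_ge0 => x _; rewrite lee_fin powR_ge0.
case: (\int[lebesgue_rV]_(x in hcube a l) _)%E => // J.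
rewrite -!EFinM !lee_fin => J0 JK.
rewrite ![_^-1 * _]mulrC.
rewrite [X in X^-1 * _](_ : _ = 61 / 200) in JK; last by lra.
set k : R := (61 / 200)^-1 in JK *.
have k0 : 0 <= k by rewrite invr_ge0; lra.
set y := S / l ^+ d in S1 h JK.
have Jy : J / l ^+ d <= k * (y * y `^ e).
  rewrite ler_pdivrMr//; apply: (le_trans JK).
  by rewrite le_eqVlt; apply/orP; left; apply/eqP; rewrite /y; field; rewrite gt_eqF.
have y0 := ltW S1.
have yp : (y * y `^ e) `^ (r - 1) = y `^ (beta - 1).
  rewrite -{1}(powRr1 y0) -powRD ?(gt_eqF S1) ?implybT// -powRrM; congr powR.
  have -> : 1 + e = (1 / (r - 1)) / q1 by rewrite hr mulrAC divff ?mul1r// gt_eqF// invr_gt0.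
  by rewrite /q1 invrK mul1r mulrAC mulVf ?mul1r// gt_eqF.
apply: (@le_trans _ _ (W / l ^+ d * (k `^ (r - 1) * y `^ (beta - 1)))).
  rewrite ler_pM2l// -yp -powRM//; last exact: mulr_ge0 y0 (powR_ge0 _ _).
  apply: ge0_ler_powR => //; rewrite ?nnegrE.
  - exact: ltW.
  - exact: divr_ge0 J0 (ltW ld0).
  - exact: mulr_ge0 k0 (mulr_ge0 y0 (powR_ge0 _ _)).
by rewrite mulrCA ler_wpM2l// powR_ge0.
Qed.

(** The hypothesis splits A into A^((r-1)/(beta-1)) and the power r - 1 of (A^q1)^e, which is at
    most 61/50. Then k 61/50 = 4, and 4^(r-1) <= 2^(rd+r). *)
Lemma Ap_const_le : (r - 1) * q1 * (1 + e) = 1 ->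
  ((61 / 200)^-1) `^ (r - 1) * A <=
  2 `^ (r * d%:R + r) * A `^ ((r - 1) / (beta - 1)).
Proof.
move=> hr2; have A0 : 0 < A by exact: Ap_gt0 hw.
have b0 : 0 < beta - 1 by rewrite subr_gt0.
have r0 : 0 < r - 1 by rewrite subr_gt0.
have q0 : 0 < q1 by rewrite invr_gt0.
have t0 : 0 < A `^ q1 by rewrite powR_gt0.
set k : R := (61 / 200)^-1.
have k0 : 0 <= k by rewrite invr_ge0; lra.
have et : e * (2 * A `^ q1) <= 1.
  apply: le_trans he; rewrite -mulrA ler_pM2l//; apply: ler_pM => //.
  - exact: ltW.
  - by rewrite -{1}(expr1 2) ler_eXn2l// ltr1n.
  - rewrite ler_peMl ?(ltW t0)//.
    by rewrite -[leLHS](powRr0 beta); apply: ler_powR; exact: ltW.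
have te := powR_le_61div50 t0 (ltW e0) et.
have -> : k `^ (r - 1) * A =
    (k * (A `^ q1) `^ e) `^ (r - 1) * A `^ ((r - 1) / (beta - 1)).
  rewrite powRM ?powR_ge0// -mulrA; congr (_ * _).
  rewrite -!powRrM -powRD ?(gt_eqF A0) ?implybT// -/q1.
  rewrite (_ : _ + _ = (r - 1) * q1 * (1 + e)); last by ring.
  by rewrite hr2 powRr1// ltW.
rewrite ler_wpM2r ?powR_ge0//.
apply: (@le_trans _ _ ((2 `^ 2) `^ (r - 1))).
  apply: ge0_ler_powR; rewrite ?nnegrE ?powR_ge0 ?mulr_ge0 ?powR_ge0 ?(ltW r0)//.
  rewrite powR_mulrn// /k -ler_pdivlMl ?invr_gt0 ?invrK//; lra.
rewrite -powRrM; apply: ler_powR; first by rewrite ler1n.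
have d1 : 1 <= d%:R :> R by rewrite ler1n.
have : r <= r * d%:R by rewrite ler_peMr//; lra.
lra.
Qed.

End improvement.

Theorem theorem1p2 (R : realType) (d : nat) (beta : R) (w : 'rV[R]_d -> R)
    (hd : (1 <= d)%N) (hbeta : 1 < beta) (hw : Ap_weight beta w) :
  let A := fine (Ap_char beta w) in
  let r := beta * (1 + 2 `^ (beta * d%:R / (beta - 1))
                       * beta `^ (beta / (beta - 1)) * A `^ (1 / (beta - 1)))
           / (beta + 2 `^ (beta * d%:R / (beta - 1))
                       * beta `^ (beta / (beta - 1)) * A `^ (1 / (beta - 1))) in
  [/\ 1 < r, r < beta, Ap_weight r w &
      (Ap_char r w <=
        (2 `^ (r * d%:R + r) * A `^ ((r - 1) / (beta - 1)))%:E)%E].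
Proof.
move=> A; set M := 2 `^ _ * _ * _ => r.
have A0 : 0 < A by exact: Ap_gt0 hw.
have b0 : 0 < beta by rewrite (lt_trans ltr01).
have b1 : 0 < beta - 1 by rewrite subr_gt0.
have M0 : 0 < M by rewrite !mulr_gt0 ?powR_gt0.
have [r1 rb hr hr2] := reverse_hoelder_exponent hbeta M0.
rewrite -/r in r1 rb hr hr2.
have e0 : 0 < beta / M by rewrite divr_gt0.
(* The factor beta^(beta/(beta-1)) of [M] cancels both beta and beta^(1/(beta-1)), which leaves 2^d
   / 2^(beta d/(beta-1)). *)
have he : beta / M * 2 ^+ d * (beta `^ (beta - 1)^-1 * A `^ (beta - 1)^-1) <= 1.
  have bE : beta `^ (beta / (beta - 1)) = beta * beta `^ (beta - 1)^-1.
    rewrite -[X in _ = X * _](powRr1 (ltW b0)) -powRD ?(gt_eqF b0) ?implybT//; congr powR.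
    by field; rewrite gt_eqF.
  have DE : 2 ^+ d <= 2 `^ (beta * d%:R / (beta - 1)) :> R.
    rewrite -powR_mulrn//; apply: ler_powR; first by rewrite ler1n.
    by rewrite ler_pdivlMr// mulrC ler_wpM2r//; lra.
  rewrite /M mul1r bE.
  set B := beta `^ _; set t := A `^ _; set D := 2 `^ _ in DE *.
  have B0 : 0 < B by exact: powR_gt0.
  have t0 : 0 < t by exact: powR_gt0.
  have D0 : 0 < D by exact: powR_gt0.
  have -> : beta / (D * (beta * B) * t) * 2 ^+ d * (B * t) = 2 ^+ d / D.
    by field; rewrite !gt_eqF.
  by rewrite ler_pdivrMr// mul1r.
have bound : (Ap_char r w <=
    (2 `^ (r * d%:R + r) * A `^ ((r - 1) / (beta - 1)))%:E)%E.
  apply: (le_trans (Ap_char_improve hd hbeta hw r1 e0 hr he)).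
  by rewrite lee_fin; exact: Ap_const_le hd hbeta hw r1 e0 he hr2.
split=> //; split; first exact: hw.1.
exact: le_lt_trans bound (ltry _).
Qed.
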